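(* Let $$F(t^1,t^2,t^3)=\frac12(t^1)^2t^3+\frac12t^1(t^2)^2-\frac1{24}(t^2)^4+t^2e^{t^3}$$ be the Dubrovin–Frobenius potential of the extended affine Weyl group $A_2^{(1)}$. There are numbers $b_{i,j},d_{i,j}$ ($1\le i\le j$) with $b_{1,1}=-8$, $d_{1,1}=1$, satisfying the recursion relations (R-even) and (R-odd) below for all integers $k,q\ge0$, such that the series $$F^o(t^1,t^2,t^3,s)=s t^1+(t^2)^2 \sum_{p,q\geq 0}a_{p,q}\,s^p\,\bigl(t^3-3 \log t^2\bigr)^q,$$ with $$a_{p,q}=\frac{(-1)^{\frac{p-1}{2}} 2^{2 p-6}}{p!\, q!} \sum _{j=1}^{\frac{p+1}{2}} j^q \left(\sum_{i=1}^j i^{-2 j+p+3} b_{i,j}\right)\quad (p\text{ odd}),$$ $$a_{p,q}=\frac{(-1)^{p/2}}{2^{q-1} p!\, q!} \left(\sum _{j=2}^{\frac{p}{2}+1} (2 j-1)^q \left(\sum _{i=1}^j (-1)^{i+1} (4 i-2)^{-2 j+p+4} d_{i,j}\right)+2^{p-1}\right)\quad (p\text{ even}),$$ is a solution of the open WDVV equations associated to $F$. It satisfies the quasihomogeneity equation $$t^1 \frac{\partial F^{o}}{\partial t^1}+\frac{1}{2}t^2 \frac{\partial F^{o}}{\partial t^2}+\frac{3}{2}\frac{\partial F^{o}}{\partial t^3} = F^{o}$$ and the conditions $\frac{\partial^2F^o}{\partial t^1\partial t^\alpha}=0$ for $1\le\alpha\le3$ and $\frac{\partial^2F^o}{\partial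 t^1\partial s}=1$. The recursion relations are as follows (empty sums are $0$). (R-even), corresponding to $p=2k$: $$\begin{aligned} &\tilde{A}_{k,q}+\sum _{j=0}^q \sum _{r=2}^{k+1} \sum _{m=1}^r \tilde{B}_{k,q,m,r,j} d_{m,r}+\sum _{i=0}^k \sum _{j=0}^q \sum _{t=1}^{-i+k+1} \sum _{n=1}^t \tilde{C}_{k,q,n,t,i,j} b_{n,t}+\sum _{i=0}^k \sum _{j=0}^q \sum _{t=1}^i \sum _{n=1}^t \tilde{D}_{k,q,n,t,i,j} b_{n,t}\\ &+\sum _{i=0}^k \sum _{j=0}^q \sum _{t=1}^{-i+k+1} \sum _{n=1}^t \sum _{r=2}^{i+1} \sum _{m=1}^r \tilde{E}_{k,q,n,t,m,r,i,j} b_{n,t} d_{m,r}+\sum _{i=0}^k \sum _{j=0}^q \sum _{t=1}^i \sum _{n=1}^t \sum _{r=2}^{-i+k+2} \sum _{m=1}^r \tilde{F}_{k,q,n,t,m,r,i,j} b_{n,t} d_{m,r}=0. \end{aligned}$$ (R-odd), corresponding to $p=2k+1$: $$\begin{aligned} &\sum _{j=0}^q \sum _{r=1}^{k+1} \sum _{m=1}^r \tilde{G}_{k,q,m,r,j} b_{m,r}+\sum _{i=0}^k \sum _{j=0}^q \sum _{r=2}^{i+1} \sum _{m=1}^r \tilde{H}_{k,q,m,r,i,j} d_{m,r}+\sum _{i=0}^k \sum _{j=0}^q \sum _{t=2}^{-i+k+2} \sum _{n=1}^t \tilde{I}_{k,q,n,t,i,j} d_{n,t}\\ &+\sum _{i=0}^k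 \sum _{j=0}^q \sum _{r=1}^{i+1} \sum _{t=1}^{-i+k+1} \sum _{m=1}^r \sum _{n=1}^t \tilde{J}_{k,q,m,r,n,t,i,j} b_{m,r} b_{n,t}+\sum _{i=0}^k \sum _{j=0}^q \sum _{r=2}^{i+1} \sum _{t=2}^{-i+k+2} \sum _{m=1}^r \sum _{n=1}^t \tilde{K}_{k,q,m,r,n,t,i,j} d_{m,r} d_{n,t}=0. \end{aligned}$$ The explicit numbers $\tilde A,\dots,\tilde K$ are $$\tilde{A}_{k,q}=\sum _{j=0}^q \frac{(-1)^k 2^{-j+2 k-2}}{j! (2 k)! (q-j)!},$$ $$\tilde{B}_{k,q,m,r,j}=\frac{(36 r^2-72 r+35) (2 r-1)^j (-1)^{k+m} 2^{-j+2 k-2 r+3} (2 m-1)^{2 k-2 r+4}}{j! (2 k)! (q-j)!},$$ $$\tilde{C}_{k,q,n,t,i,j}=\frac{ (-1)^{k+1} (1-2 t) (-2 i+2 k+1) 2^{-2 i-j+4 k-5} t^{q-j} n^{-2 (i-k+t-2)}}{(2 i)!\, j!\, (-2 i+2 k+1)! (q-j)!},$$ $$\tilde{D}_{k,q,n,t,i,j}=\frac{(-1)^{k+1} (2 t-1) (-i+k+1) t^{j+1} n^{2 i-2 t+2} 2^{2 i+j+2 k-q-5}}{(2 i-1)!\, j!\, (-2 i+2 k+2)! (q-j)!},$$ $$\tilde{E}_{k,q,n,t,m,r,i,j}=\frac{(-1)^{k+m} (2 r-2 t-1)(-2 i+2 k+1) (2 r-1)^{j+1} (2 m-1)^{2 i-2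 r+4} 2^{-2 i-j+4 k-2 r} n^{-2 (i-k+t-2)}t^{q-j}}{(2 i)!\, j!\, (-2 i+2 k+1)! (q-j)!},$$ $$\tilde{F}_{k,q,n,t,m,r,i,j}=\frac{(-1)^{k+m} (-2 r+2 t+1)(-i+k+1) (2 r-1)^{q-j}(2 m-1)^{-2 i+2 k-2 r+6} 2^{2 i+j+2 k-q-2 r} n^{2 i-2 t+2}t^{j+1} }{(2 i-1)!\, j!\, (-2 i+2 k+2)! (q-j)!},$$ $$\tilde{G}_{k,q,m,r,j}=\frac{(-1)^{k+1} 16^{k-1} (9 r^2-9 r+2) r^j m^{2 k-2 r+4}}{j! (2 k+1)! (q-j)!},$$ $$\tilde{H}_{k,q,m,r,i,j}=\frac{(-1)^{k+m+1}2^{2 k-q-2 r+8}(r-1) (-i+k+1) (2 r-1)^{j+1} (2 m-1)^{2 i-2 r+4} }{(2 i)!\, j!\, (-2 i+2 k+2)! (q-j)!},$$ $$\tilde{I}_{k,q,n,t,i,j}=\frac{(-1)^{k+n+1} 2^{2 k-q-2 t+8}(1-t) (-i+k+1) (2 t-1)^{q-j}(2 n-1)^{-2 i+2 k-2 t+6} }{(2 i)!\, j!\, (-2 i+2 k+2)! (q-j)!},$$ $$\tilde{J}_{k,q,m,r,n,t,i,j}=\frac{(-1)^{k+1} 2^{4 k-7}(r-t) r^{j+1} m^{2 i-2 r+4} t^{q-j} n^{-2 (i-k+t-2)}}{(2 i+1)!\, j!\, (2 k-2 i)! (q-j)!},$$ $$\tilde{K}_{k,q,m,r,n,t,i,j}=\frac{(-1)^{k+m+n}2^{2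 k-q-2 r-2 t+13}(r-t)(-i+k+1) (2 r-1)^{j+1} (2 m-1)^{2 i-2 r+4} (2 t-1)^{q-j} (2 n-1)^{-2 i+2 k-2 t+6} }{(2 i)!\, j!\, (-2 i+2 k+2)! (q-j)!}.$$
   Context: Superscripts on $t$ are indices, and repeated Greek indices are summed from $1$ to $N=3$. The constant matrix is $\eta_{\alpha\beta}=\frac{\partial^3F}{\partial t^1\partial t^\alpha\partial t^\beta}$, so $\eta_{13}=\eta_{31}=\eta_{22}=1$ and all other entries are $0$; $(\eta^{\alpha\beta})$ denotes its inverse. The open WDVV equations associated to $F$, for an unknown $F^o(t^1,\dots,t^N,s)$, are the following two families of equations, required for all $1\le\alpha,\beta,\gamma\le N$: $$\frac{\partial^3F}{\partial t^{\alpha}\partial t^{\beta}\partial t^{\mu}}\eta^{\mu\nu}\frac{\partial^2 F^{o}}{\partial t^{\nu}\partial t^{\gamma}}+\frac{\partial^2 F^{o}}{\partial t^{\alpha}\partial t^{\beta}}\frac{\partial^2 F^{o}}{\partial s\partial t^{\gamma}}=\frac{\partial^3F}{\partial t^{\gamma}\partial t^{\beta}\partial t^{\mu}}\eta^{\mu\nu}\frac{\partial^2 F^{o}}{\partial t^{\nu}\partial t^{\alpha}}+\frac{\partial^2 F^{o}}{\partial t^{\gamma}\partial t^{\beta}}\frac{\partial^2 F^{o}}{\partial s\partial t^{\alpha}},$$ $$\frac{\partial^3F}{\partial t^{\alpha}\partial t^{\beta}\partial t^{\mu}}\eta^{\mu\nu}\frac{\partial^2 F^{o}}{\partial t^{\nu}\partial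 s}+\frac{\partial^2 F^{o}}{\partial t^{\alpha}\partial t^{\beta}}\frac{\partial^2 F^{o}}{\partial s^2}=\frac{\partial^2 F^{o}}{\partial s\partial t^{\beta}}\frac{\partial^2 F^{o}}{\partial s\partial t^{\alpha}}.$$ The series $F^o$ is a Taylor series in $s$ and $u=t^3-3\log t^2$, and is understood as a formal power series in $s$ and $u$ with coefficients in $\mathbb{C}[t^1,(t^2)^{\pm1}]$; derivatives act by the chain rule, with $\partial u/\partial t^2=-3/t^2$, $\partial u/\partial t^3=1$, and $e^{t^3}$ is identified with $(t^2)^3e^{u}=(t^2)^3\sum_{n\ge0}u^n/n!$. *)

(* Defs.v *)
From HB Require Import structures.
From mathcomp Require Import all_boot all_order all_algebra.
From mathcomp Require Import finmap boolp reals complex.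
From mathcomp.multinomials Require Import monalg.

Set Implicit Arguments.
Unset Strict Implicit.
Unset Printing Implicit Defensive.

Import GRing.Theory.
Local Open Scope ring_scope.

(* The algebra R[M] of an additive commutative monoid M. The ring structure   *)
(* of {malg R[M]} in monalg.v asks that 0 be the only invertible element of M *)
(* and so excludes Laurent monomials (M = int); hence this copy.              *)
Definition monoid_algebra (R : comNzRingType) (M : nmodType) := {malg R[M]}.

Section MonoidAlgebra.
Context (R : comNzRingType) (M : nmodType).
Implicit Types (g : {malg R[M]}).

HB.instance Definition _ := GRing.Lmodule.on (monoid_algebra R M).

Fact ma_mul_key : unit. Proof. by []. Qed.
Definition ma_mul := locked_with ma_mul_key (fun g1 g2 =>
  \sum_(k1 <- msupp g1) \sum_(k2 <- msupp g2)
    << g1@_k1 * g2@_k2 *g (k1 + k2)%R >> : {malg R[M]}).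

Lemma ma_mulE g1 g2 : ma_mul g1 g2 =
  \sum_(k1 <- msupp g1) \sum_(k2 <- msupp g2)
    << g1@_k1 * g2@_k2 *g (k1 + k2)%R >>.
Proof. by rewrite /ma_mul unlock. Qed.

Lemma ma_mulw (d1 d2 : {fset M}) g1 g2 :
  (msupp g1 `<=` d1)%fset -> (msupp g2 `<=` d2)%fset ->
  ma_mul g1 g2 = \sum_(k1 <- d1) \sum_(k2 <- d2)
    << g1@_k1 * g2@_k2 *g (k1 + k2)%R >>.
Proof.
move=> le_d1 le_d2; rewrite ma_mulE (big_fset_incl _ le_d1) /=.
  apply/eq_bigr=> k1 _; apply/big_fset_incl => // k _ /mcoeff_outdom ->.
  by rewrite mulr0 monalgU0.
move=> k _ /mcoeff_outdom g1k.
by rewrite big1 => // k' _; rewrite g1k mul0r monalgU0.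
Qed.

Lemma ma_mulC : commutative ma_mul.
Proof.
move=> g1 g2; rewrite !ma_mulE exchange_big; apply/eq_bigr=> k _.
by apply/eq_bigr=> l _; rewrite mulrC [(k + l)%R]addrC.
Qed.

Lemma ma_mulUU c1 c2 (k1 k2 : M) :
  ma_mul << c1 *g k1 >> << c2 *g k2 >> = << c1 * c2 *g (k1 + k2)%R >>.
Proof. by rewrite (ma_mulw msuppU_le msuppU_le) !big_seq_fset1 !mcoeffUU. Qed.

Lemma ma_mulDl : left_distributive ma_mul +%R.
Proof.
move=> g1 g2 g.
rewrite [in RHS](ma_mulw (fsubsetUl _ (msupp g2)) (fsubset_refl _)).
rewrite [in RHS](ma_mulw (fsubsetUr (msupp g1) _) (fsubset_refl _)).
rewrite (ma_mulw (msuppD_le _ _) (fsubset_refl _)).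
rewrite -big_split /=; apply/eq_bigr=> k1 _.
rewrite -big_split /=; apply/eq_bigr=> k2 _.
by rewrite mcoeffD mulrDl monalgUD.
Qed.

Lemma ma_mulDr : right_distributive ma_mul +%R.
Proof. by move=> g1 g2 g; rewrite ma_mulC ma_mulDl !(ma_mulC g1). Qed.

Lemma ma_mul0 : left_zero 0 ma_mul.
Proof. by move=> g; rewrite ma_mulE msupp0 big_seq_fset0. Qed.

Lemma ma_mulr0 : right_zero 0 ma_mul.
Proof. by move=> g; rewrite ma_mulC ma_mul0. Qed.

Lemma ma_mul_suml I (r : seq I) (F : I -> {malg R[M]}) g :
  ma_mul (\sum_(i <- r) F i) g = \sum_(i <- r) ma_mul (F i) g.
Proof. exact: (big_morph (ma_mul^~ g) (fun _ _ => ma_mulDl _ _ _) (ma_mul0 _)). Qed.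

Lemma ma_mul_sumr I (r : seq I) (F : I -> {malg R[M]}) g :
  ma_mul g (\sum_(i <- r) F i) = \sum_(i <- r) ma_mul g (F i).
Proof. exact: (big_morph (ma_mul g) (fun _ _ => ma_mulDr _ _ _) (ma_mulr0 _)). Qed.

Lemma ma_mulA : associative ma_mul.
Proof.
move=> g1 g2 g3; rewrite (monalgE g1) (monalgE g2) (monalgE g3).
rewrite !ma_mul_suml; apply/eq_bigr=> k1 _.
rewrite [LHS]ma_mul_sumr [in RHS](ma_mul_sumr _ _ << _ *g k1 >>) ma_mul_suml.
apply/eq_bigr=> k2 _.
rewrite !ma_mul_sumr; apply/eq_bigr=> k3 _.
by rewrite !ma_mulUU mulrA addrA.
Qed.

Lemma ma_mul1 : left_id << 1 *g (0 : M)%R >> ma_mul.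
Proof.
move=> g; rewrite [in LHS](monalgE g) ma_mul_sumr [RHS]monalgE.
by apply/eq_bigr=> k _; rewrite ma_mulUU mul1r add0r.
Qed.

Lemma ma_oner_neq0 : << 1 *g (0 : M)%R >> != 0 :> {malg R[M]}.
Proof. by rewrite monalgU_eq0 oner_eq0. Qed.

HB.instance Definition _ := GRing.Zmodule_isComNzRing.Build
  (monoid_algebra R M) ma_mulA ma_mulC ma_mul1 ma_mulDl ma_oner_neq0.

Definition ma_mon (c : R) (k : M) : monoid_algebra R M := << c *g k >>.

Definition ma_lin (h : M -> monoid_algebra R M) (g : monoid_algebra R M) :
  monoid_algebra R M := \sum_(k <- msupp g) g@_k *: h k.

End MonoidAlgebra.

Record fps (A : comNzRingType) := Fps { fps_coef :> nat -> A }.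

Section FormalPowerSeries.
Context (A : comNzRingType).
Implicit Types (X Y Z : fps A).

HB.instance Definition _ := gen_eqMixin (fps A).
HB.instance Definition _ := gen_choiceMixin (fps A).

Lemma fpsP X Y : (forall n, X n = Y n) <-> X = Y.
Proof. by case: X Y => [X] [Y]; split=> [/funext /= ->|->]. Qed.

Definition fps_add X Y := Fps (fun n => X n + Y n).
Definition fps_opp X := Fps (fun n => - X n).
Definition fpsC (c : A) := Fps (fun n => if n is 0 then c else 0).

Lemma fps_addA : associative fps_add.
Proof. by move=> X Y Z; apply/fpsP=> n /=; rewrite addrA. Qed.
Lemma fps_addC : commutative fps_add.
Proof. by move=> X Y; apply/fpsP=> n /=; rewrite addrC. Qed.
Lemma fps_add0 : left_id (fpsC 0) fps_add.
Proof. by move=> X; apply/fpsP=> -[|n] /=; rewrite add0r. Qed.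
Lemma fps_addN : left_inverse (fpsC 0) fps_opp fps_add.
Proof. by move=> X; apply/fpsP=> -[|n] /=; rewrite addNr. Qed.

HB.instance Definition _ :=
  GRing.isZmodule.Build (fps A) fps_addA fps_addC fps_add0 fps_addN.

Fact fps_key : unit. Proof. by []. Qed.
Definition fps_mul := locked_with fps_key
  (fun X Y => Fps (fun n => \sum_(i < n.+1) X i * Y (n - i)%N)).
Lemma fps_mulE X Y n : fps_mul X Y n = \sum_(i < n.+1) X i * Y (n - i)%N.
Proof. by rewrite /fps_mul unlock. Qed.


Definition fps_trunc m X : {poly A} := \poly_(i < m) X i.

Lemma fps_mul_trunc X Y m n : (n < m)%N ->
  fps_mul X Y n = (fps_trunc m X * fps_trunc m Y)`_n.
Proof.
move=> nm; rewrite fps_mulE coefM; apply/eq_bigr=> i _; rewrite !coef_poly.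
have im : (i < m)%N by rewrite (leq_trans (ltn_ord i)).
by rewrite im (leq_ltn_trans (leq_subr i n) nm).
Qed.

Lemma fps_mulC : commutative fps_mul.
Proof.
by move=> X Y; apply/fpsP=> n; rewrite !(fps_mul_trunc _ _ (ltnSn n)) mulrC.
Qed.

Lemma fps_mulA : associative fps_mul.
Proof.
move=> X Y Z; apply/fpsP=> n.
rewrite [LHS]fps_mulE [RHS]fps_mulE.
transitivity ((fps_trunc n.+1 X * (fps_trunc n.+1 Y * fps_trunc n.+1 Z))`_n).
  rewrite coefM; apply/eq_bigr=> i _; rewrite coef_poly ltn_ord.
  by rewrite (@fps_mul_trunc _ _ n.+1) // ltnS leq_subr.
rewrite mulrA coefM; apply/eq_bigr=> i _; rewrite (@fps_mul_trunc _ _ n.+1) //.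
by rewrite [in LHS]coef_poly ltnS leq_subr.
Qed.

Lemma fps_mul1 : left_id (fpsC 1) fps_mul.
Proof.
move=> X; apply/fpsP=> n; rewrite fps_mulE big_ord_recl /= mul1r subn0.
by rewrite big1 ?addr0 // => i _; rewrite mul0r.
Qed.

Lemma fps_mulDl : left_distributive fps_mul +%R.
Proof.
move=> X Y Z; apply/fpsP=> n; rewrite [RHS]/= !fps_mulE -big_split /=.
by apply/eq_bigr=> i _; rewrite mulrDl.
Qed.

Lemma fps_oner_neq0 : fpsC 1 != fpsC 0.
Proof. by apply/eqP=> /fpsP /(_ 0%N) /= /eqP; rewrite oner_eq0. Qed.

HB.instance Definition _ := GRing.Zmodule_isComNzRing.Build
  (fps A) fps_mulA fps_mulC fps_mul1 fps_mulDl fps_oner_neq0.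

Definition fpsX := Fps (fun n => (n == 1)%:R : A).

Definition fps_deriv X := Fps (fun n => X n.+1 *+ n.+1).

Definition fps_map (f : A -> A) X := Fps (fun n => f (X n)).

End FormalPowerSeries.

Section FlatSeries.
Context (K : fieldType).

(* coef K is K[t^1, (t^2)^{+-1}, t^3] and series K is coef K [[u]][[s]], so   *)
(* that X p q is the coefficient of s^p u^q. The variable u stands for        *)
(* t^3 - 3 log t^2. As log t^2 is transcendental over the other variables,    *)
(* t^3 and u are algebraically independent; t^3 itself is kept as a           *)
(* coefficient variable because F (but none of its third derivatives)         *)
(* contains it outside of e^{t^3}.                                            *)
Definition exponent : nmodType := (nat * int * nat)%type.
Definition coef := monoid_algebra K exponent.
Definition series := fps (fps coef).

Definition mon (a : nat) (b : int) (c : nat) : series :=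
  fpsC (fpsC (ma_mon 1 (a, b, c))).
Definition cst (x : K) : series := fpsC (fpsC (ma_mon x (0 : exponent))).

Definition t1 : series := mon 1 0 0.
Definition t2 : series := mon 0 1 0.
Definition t2V : series := mon 0 (-1) 0.
Definition t3 : series := mon 0 0 1.
Definition u : series := fpsC (@fpsX coef).
Definition s : series := @fpsX (fps coef).

Definition exp_u : series :=
  fpsC (Fps (fun n => ma_mon (n`!%:R)^-1 (0 : exponent) : coef)).

(* e^{t^3} = e^{u + 3 log t^2} *)
Definition exp_t3 : series := t2 ^+ 3 * exp_u.

Definition coef_d1 : coef -> coef :=
  ma_lin (fun k => let: (a, b, c) := k in ma_mon a%:R (a.-1, b, c)).
Definition coef_d2 : coef -> coef :=
  ma_lin (fun k => let: (a, b, c) := k in ma_mon b%:~R (a, b - 1, c)).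
Definition coef_d3 : coef -> coef :=
  ma_lin (fun k => let: (a, b, c) := k in ma_mon c%:R (a, b, c.-1)).

Definition coefwise (f : coef -> coef) : series -> series :=
  fps_map (fps_map f).

Definition ds : series -> series := @fps_deriv (fps coef).
Definition du : series -> series := fps_map (@fps_deriv coef).

Definition d1 (X : series) : series := coefwise coef_d1 X.
Definition d2 (X : series) : series := coefwise coef_d2 X - 3 * t2V * du X.
Definition d3 (X : series) : series := coefwise coef_d3 X + du X.

(* 'I_3 is numbered from 0: dt 0, dt 1, dt 2 are the derivatives with respect *)
(* to t^1, t^2, t^3.                                                          *)
Definition dt (al : 'I_3) : series -> series :=
  match val al with 0 => d1 | 1 => d2 | _ => d3 end.

Definition potential : series :=
  cst (1 / 2) * t1 ^+ 2 * t3 + cst (1 / 2) * t1 * t2 ^+ 2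
  - cst (1 / 24) * t2 ^+ 4 + t2 * exp_t3.

Definition metric (F : series) : 'M[series]_3 :=
  \matrix_(al, be) dt 0 (dt al (dt be F)).

Definition open_WDVV (F Fo : series) : Prop :=
  exists2 etaI : 'M[series]_3, metric F *m etaI = 1%:M &
  forall al be ga : 'I_3,
    \sum_mu \sum_nu dt al (dt be (dt mu F)) * etaI mu nu * dt nu (dt ga Fo)
      + dt al (dt be Fo) * ds (dt ga Fo)
    = \sum_mu \sum_nu dt ga (dt be (dt mu F)) * etaI mu nu * dt nu (dt al Fo)
      + dt ga (dt be Fo) * ds (dt al Fo)
  /\
    \sum_mu \sum_nu dt al (dt be (dt mu F)) * etaI mu nu * dt nu (ds Fo)
      + dt al (dt be Fo) * ds (ds Fo)
    = ds (dt be Fo) * ds (dt al Fo).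

Definition quasihomogeneous (Fo : series) : Prop :=
  t1 * d1 Fo + cst (1 / 2) * t2 * d2 Fo + cst (3 / 2) * d3 Fo = Fo.

End FlatSeries.

(* Exponents which are differences are formed in int (x ^ e), so no           *)
(* subtraction in them is truncated. Truncated subtraction of natural numbers *)
(* only occurs as q - j with j <= q, as k - i with i <= k, and in             *)
(* ((2 * i).-1)`!, which only occurs under an empty sum when i = 0.           *)
Section Coefficients.
Context (K : fieldType).
Implicit Types (b d : nat -> nat -> K) (p q k i j m n r t : nat).

Definition a_coef b d p q : K :=
  if odd p then
    (-1) ^+ ((p - 1) %/ 2) * 2 ^ (2 * p%:Z - 6) / (p`!%:R * q`!%:R)
    * \sum_(1 <= j < ((p + 1) %/ 2).+1) j%:R ^+ q *
        \sum_(1 <= i < j.+1) i%:R ^ (- (2 * j%:Z) + p%:Z + 3) * b i j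
  else
    (-1) ^+ (p %/ 2) / (2 ^ (q%:Z - 1) * p`!%:R * q`!%:R)
    * (\sum_(2 <= j < (p %/ 2 + 1).+1) (2 * j%:R - 1) ^+ q *
         (\sum_(1 <= i < j.+1)
            (-1) ^+ (i + 1) * (4 * i%:R - 2) ^ (- (2 * j%:Z) + p%:Z + 4)
            * d i j)
       + 2 ^ (p%:Z - 1)).

Definition open_potential b d : series K :=
  s K * t1 K + t2 K ^+ 2 *
    Fps (fun p => Fps (fun q =>
      ma_mon (a_coef b d p q) (0 : exponent) : coef K)).

Definition cA k q : K :=
  \sum_(0 <= j < q.+1)
    (-1) ^+ k * 2 ^ (- j%:Z + 2 * k%:Z - 2)
    / (j`!%:R * ((2 * k)`!)%:R * ((q - j)`!)%:R).

Definition cB k q m r j : K :=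
  (36 * r%:R ^+ 2 - 72 * r%:R + 35) * (2 * r%:R - 1) ^+ j * (-1) ^+ (k + m)
  * 2 ^ (- j%:Z + 2 * k%:Z - 2 * r%:Z + 3)
  * (2 * m%:R - 1) ^ (2 * k%:Z - 2 * r%:Z + 4)
  / (j`!%:R * ((2 * k)`!)%:R * ((q - j)`!)%:R).

Definition cC k q n t i j : K :=
  (-1) ^+ (k + 1) * (1 - 2 * t%:R) * (- (2 * i%:R) + 2 * k%:R + 1)
  * 2 ^ (- (2 * i%:Z) - j%:Z + 4 * k%:Z - 5) * t%:R ^+ (q - j)
  * n%:R ^ (- (2 * (i%:Z - k%:Z + t%:Z - 2)))
  / (((2 * i)`!)%:R * j`!%:R * ((2 * (k - i) + 1)`!)%:R * ((q - j)`!)%:R).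

Definition cD k q n t i j : K :=
  (-1) ^+ (k + 1) * (2 * t%:R - 1) * (- i%:R + k%:R + 1) * t%:R ^+ (j + 1)
  * n%:R ^ (2 * i%:Z - 2 * t%:Z + 2)
  * 2 ^ (2 * i%:Z + j%:Z + 2 * k%:Z - q%:Z - 5)
  / (((2 * i).-1`!)%:R * j`!%:R * ((2 * (k - i) + 2)`!)%:R * ((q - j)`!)%:R).

Definition cE k q n t m r i j : K :=
  (-1) ^+ (k + m) * (2 * r%:R - 2 * t%:R - 1) * (- (2 * i%:R) + 2 * k%:R + 1)
  * (2 * r%:R - 1) ^+ (j + 1) * (2 * m%:R - 1) ^ (2 * i%:Z - 2 * r%:Z + 4)
  * 2 ^ (- (2 * i%:Z) - j%:Z + 4 * k%:Z - 2 * r%:Z)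
  * n%:R ^ (- (2 * (i%:Z - k%:Z + t%:Z - 2))) * t%:R ^+ (q - j)
  / (((2 * i)`!)%:R * j`!%:R * ((2 * (k - i) + 1)`!)%:R * ((q - j)`!)%:R).

Definition cF k q n t m r i j : K :=
  (-1) ^+ (k + m) * (- (2 * r%:R) + 2 * t%:R + 1) * (- i%:R + k%:R + 1)
  * (2 * r%:R - 1) ^+ (q - j)
  * (2 * m%:R - 1) ^ (- (2 * i%:Z) + 2 * k%:Z - 2 * r%:Z + 6)
  * 2 ^ (2 * i%:Z + j%:Z + 2 * k%:Z - q%:Z - 2 * r%:Z)
  * n%:R ^ (2 * i%:Z - 2 * t%:Z + 2) * t%:R ^+ (j + 1)
  / (((2 * i).-1`!)%:R * j`!%:R * ((2 * (k - i) + 2)`!)%:R * ((q - j)`!)%:R).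

Definition cG k q m r j : K :=
  (-1) ^+ (k + 1) * 16 ^ (k%:Z - 1) * (9 * r%:R ^+ 2 - 9 * r%:R + 2)
  * r%:R ^+ j * m%:R ^ (2 * k%:Z - 2 * r%:Z + 4)
  / (j`!%:R * ((2 * k + 1)`!)%:R * ((q - j)`!)%:R).

Definition cH k q m r i j : K :=
  (-1) ^+ (k + m + 1) * 2 ^ (2 * k%:Z - q%:Z - 2 * r%:Z + 8)
  * (r%:R - 1) * (- i%:R + k%:R + 1) * (2 * r%:R - 1) ^+ (j + 1)
  * (2 * m%:R - 1) ^ (2 * i%:Z - 2 * r%:Z + 4)
  / (((2 * i)`!)%:R * j`!%:R * ((2 * (k - i) + 2)`!)%:R * ((q - j)`!)%:R).

Definition cI k q n t i j : K :=
  (-1) ^+ (k + n + 1) * 2 ^ (2 * k%:Z - q%:Z - 2 * t%:Z + 8)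
  * (1 - t%:R) * (- i%:R + k%:R + 1) * (2 * t%:R - 1) ^+ (q - j)
  * (2 * n%:R - 1) ^ (- (2 * i%:Z) + 2 * k%:Z - 2 * t%:Z + 6)
  / (((2 * i)`!)%:R * j`!%:R * ((2 * (k - i) + 2)`!)%:R * ((q - j)`!)%:R).

Definition cJ k q m r n t i j : K :=
  (-1) ^+ (k + 1) * 2 ^ (4 * k%:Z - 7) * (r%:R - t%:R) * r%:R ^+ (j + 1)
  * m%:R ^ (2 * i%:Z - 2 * r%:Z + 4) * t%:R ^+ (q - j)
  * n%:R ^ (- (2 * (i%:Z - k%:Z + t%:Z - 2)))
  / (((2 * i + 1)`!)%:R * j`!%:R * ((2 * (k - i))`!)%:R * ((q - j)`!)%:R).

Definition cK k q m r n t i j : K :=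
  (-1) ^+ (k + m + n) * 2 ^ (2 * k%:Z - q%:Z - 2 * r%:Z - 2 * t%:Z + 13)
  * (r%:R - t%:R) * (- i%:R + k%:R + 1) * (2 * r%:R - 1) ^+ (j + 1)
  * (2 * m%:R - 1) ^ (2 * i%:Z - 2 * r%:Z + 4) * (2 * t%:R - 1) ^+ (q - j)
  * (2 * n%:R - 1) ^ (- (2 * i%:Z) + 2 * k%:Z - 2 * t%:Z + 6)
  / (((2 * i)`!)%:R * j`!%:R * ((2 * (k - i) + 2)`!)%:R * ((q - j)`!)%:R).

Definition rec_even b d k q : Prop :=
  cA k q
  + \sum_(0 <= j < q.+1) \sum_(2 <= r < (k + 1).+1) \sum_(1 <= m < r.+1)
      cB k q m r j * d m r
  + \sum_(0 <= i < k.+1) \sum_(0 <= j < q.+1)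
    \sum_(1 <= t < (k - i + 1).+1) \sum_(1 <= n < t.+1)
      cC k q n t i j * b n t
  + \sum_(0 <= i < k.+1) \sum_(0 <= j < q.+1)
    \sum_(1 <= t < i.+1) \sum_(1 <= n < t.+1)
      cD k q n t i j * b n t
  + \sum_(0 <= i < k.+1) \sum_(0 <= j < q.+1)
    \sum_(1 <= t < (k - i + 1).+1) \sum_(1 <= n < t.+1)
    \sum_(2 <= r < (i + 1).+1) \sum_(1 <= m < r.+1)
      cE k q n t m r i j * b n t * d m r
  + \sum_(0 <= i < k.+1) \sum_(0 <= j < q.+1)
    \sum_(1 <= t < i.+1) \sum_(1 <= n < t.+1)
    \sum_(2 <= r < (k - i + 2).+1) \sum_(1 <= m < r.+1)
      cF k q n t m r i j * b n t * d m r
  = 0.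

Definition rec_odd b d k q : Prop :=
  \sum_(0 <= j < q.+1) \sum_(1 <= r < (k + 1).+1) \sum_(1 <= m < r.+1)
    cG k q m r j * b m r
  + \sum_(0 <= i < k.+1) \sum_(0 <= j < q.+1)
    \sum_(2 <= r < (i + 1).+1) \sum_(1 <= m < r.+1)
      cH k q m r i j * d m r
  + \sum_(0 <= i < k.+1) \sum_(0 <= j < q.+1)
    \sum_(2 <= t < (k - i + 2).+1) \sum_(1 <= n < t.+1)
      cI k q n t i j * d n t
  + \sum_(0 <= i < k.+1) \sum_(0 <= j < q.+1)
    \sum_(1 <= r < (i + 1).+1) \sum_(1 <= t < (k - i + 1).+1)
    \sum_(1 <= m < r.+1) \sum_(1 <= n < t.+1)
      cJ k q m r n t i j * b m r * b n t
  + \sum_(0 <= i < k.+1) \sum_(0 <= j < q.+1)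
    \sum_(2 <= r < (i + 1).+1) \sum_(2 <= t < (k - i + 2).+1)
    \sum_(1 <= m < r.+1) \sum_(1 <= n < t.+1)
      cK k q m r n t i j * d m r * d n t
  = 0.

End Coefficients.

(* Main.v *)
Require Import Defs.
From HB Require Import structures.
From mathcomp Require Import all_boot all_order all_algebra.
From mathcomp Require Import finmap boolp reals complex.
From mathcomp Require Import ring zify.
From mathcomp.multinomials Require Import monalg.

(* Put x = e^{u/2}, S = sin 2s, C = cos 2s, and let Q be the root of          *)
(* Q^3 = Q - x S with Q = 1 at x S = 0. Then                                  *)
(*   phi = x C (1/Q + 3 Q) / 4,   F^o = s t^1 + (t^2)^2 phi                   *)
(* is a solution in closed form. It comes from the superpotential             *)
(* lambda(z) = z^2 + a z + b + c/z of the extended affine Weyl group: s is,   *)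
(* up to an affine change, the difference of the logarithms of two of the     *)
(* three roots z of lambda(z) = F^o_s, which linearizes open WDVV.            *)
(* All derivatives of phi lie in the ring generated by y = x C / 2, Q, 1/Q    *)
(* and P = 1/(3 Q^2 - 1), with e^u = 4 y^2 + Q^2 (1 - Q^2)^2, and the open    *)
(* WDVV equations become polynomial identities there.                         *)
(* Expanding phi in powers of x S, the coefficient of x^n is a multiple of    *)
(* C S^(n-1), a combination of sin 4is (n even) or of cos (4i-2)s (n odd);    *)
(* this defines b and d. The recursions are, up to sign, the coefficients of  *)
(* 2 phi_u phi_su - 2 phi_uu phi_s = e^u (2 phi - 9 phi_u + 9 phi_uu),        *)
(* the open WDVV equation with (alpha, beta, gamma) = (2, 3, 3).              *)

Set Implicit Arguments.
Unset Strict Implicit.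
Unset Printing Implicit Defensive.
Import GRing.Theory Num.Theory.
Local Open Scope ring_scope.

(** * Formal power series *)

(** For F^o = s t^1 + (t^2)^2 phi(s, u) the homogeneity is built into the ansatz: each derivative of
    F^o that enters the equations, apart from the part coming from s t^1, is a power of t^2 times a
    combination of derivatives of phi. Hence t^2 cancels from every open WDVV equation, an equation
    with an index 1 is an identity, and what remains are five partial differential equations for phi
    alone; [wdvv_ttt] and [wdvv_tts] make this reduction. Quasihomogeneity and the normalisation in
    t^1 can be read off the ansatz.

    The five equations are verified on the closed form of phi. The root Q exists as a power series
    ([cubic_series]), and implicit differentiation of its cubic expresses all needed derivatives of
    phi through y, Q, [R] = 1/Q and [P] = 1/(3 Q^2 - 1). The relation S^2 + C^2 = 1 expresses e^u
    through y and Q ([sol_E]). Once the powers of [P] are cleared ([homogenize]), each equation is a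
    polynomial identity in y, Q, [R] modulo Q R = 1; these are the lemmas [sol_wdvv22s] to
    [sol_wdvv323], collected for the actual series in [open_solP].

    The numbers b and d are not constructed from the recursions. The coefficient of s^p in phi is a
    finite sum of exponentials in u ([open_sol_coef]), and the parity of p selects integral or
    half-integral exponents. Writing C S^n as a combination of sines or cosines of multiple
    arguments ([fcos_mul_fsin_odd], [fcos_mul_fsin_even]) gives exactly the shape of the a_{p,q},
    and b, d are the resulting numbers, suitably rescaled ([open_sol_expansion], [a_coefE]). The
    recursions then follow without induction: they compare coefficients of s^(2k) u^q and s^(2k+1)
    u^q in one of the five equations ([rec_even_sol], [rec_odd_sol]). *)

Section Fps.
Context (A : comNzRingType).
Implicit Types (X Y Z : fps A).

Lemma fps_coef0 n : (0 : fps A) n = 0.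
Proof. by case: n. Qed.

Lemma fps_coef1 n : (1 : fps A) n = (n == 0%N)%:R.
Proof. by case: n. Qed.

Lemma fps_coefD X Y n : (X + Y) n = X n + Y n.
Proof. by []. Qed.

Lemma fps_coefN X n : (- X) n = - X n.
Proof. by []. Qed.

Lemma fps_coefB X Y n : (X - Y) n = X n - Y n.
Proof. by []. Qed.

Lemma fps_coefMn X m n : (X *+ m) n = X n *+ m.
Proof.
by elim: m => [|m IH]; rewrite ?fps_coef0 // !mulrS fps_coefD IH.
Qed.

Lemma fps_coef_sum I (r : seq I) (P : pred I) (F : I -> fps A) n :
  (\sum_(i <- r | P i) F i) n = \sum_(i <- r | P i) F i n.
Proof.
apply: (big_morph (fun X : fps A => X n)) => [X Y|]; first by rewrite fps_coefD.
exact: fps_coef0.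
Qed.

Lemma fps_coefM X Y n : (X * Y) n = \sum_(i < n.+1) X i * Y (n - i)%N.
Proof. exact: fps_mulE. Qed.

Lemma fps_coefM0 X Y : (X * Y) 0%N = X 0%N * Y 0%N.
Proof. by rewrite fps_coefM big_ord1. Qed.

Lemma fps_coefCM (c : A) X n : (fpsC c * X) n = c * X n.
Proof.
rewrite fps_coefM big_ord_recl /= subn0 big1 ?addr0 // => i _.
by rewrite mul0r.
Qed.

Lemma fps_coefXM0 X : (fpsX A * X) 0%N = 0.
Proof. by rewrite fps_coefM0 mul0r. Qed.

Lemma fps_coefXMS X n : (fpsX A * X) n.+1 = X n.
Proof.
rewrite fps_coefM big_ord_recl mul0r add0r big_ord_recl /= /bump /= mul1r.
by rewrite subSS subn0 big1 ?addr0 // => i _; rewrite mul0r.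
Qed.

Lemma eq_fps_mul n X X' Y Y' :
  (forall i, (i <= n)%N -> X i = X' i) -> (forall i, (i <= n)%N -> Y i = Y' i) ->
  forall i, (i <= n)%N -> (X * Y) i = (X' * Y') i.
Proof.
move=> eX eY i le_in; rewrite !fps_coefM; apply: eq_bigr => j _.
have le_ji : (j <= i)%N by rewrite -ltnS.
by rewrite eX ?(leq_trans le_ji) // eY // (leq_trans (leq_subr _ _)).
Qed.

Fact fpsC_zmod_morphism : zmod_morphism (@fpsC A).
Proof. by move=> a b; apply/fpsP => -[|n] //=; rewrite subr0. Qed.

Fact fpsC_monoid_morphism : monoid_morphism (@fpsC A).
Proof.
split=> // a b; apply/fpsP => n; rewrite fps_coefCM.
by case: n => [|n] //=; rewrite mulr0.
Qed.

HB.instance Definition _ :=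
  GRing.isZmodMorphism.Build A (fps A) (@fpsC A) fpsC_zmod_morphism.
HB.instance Definition _ :=
  GRing.isMonoidMorphism.Build A (fps A) (@fpsC A) fpsC_monoid_morphism.

Lemma fps_expX_coef X n p : X 0%N = 0 -> (p < n)%N -> (X ^+ n) p = 0.
Proof.
move=> X0; elim: n p => // n IH p lt_pn.
rewrite exprS fps_coefM big_ord_recl X0 mul0r add0r big1 // => i _.
by rewrite IH ?mulr0 // lift0; have := ltn_ord i; lia.
Qed.

End Fps.

(* Solves [g = T g] for an operator [T] whose n-th output coefficient only    *)
(* depends on the input coefficients of index < n.                            *)
Lemma fps_fixpoint (A : comNzRingType) (T : fps A -> fps A) :
  (forall n (g h : fps A), (forall i, (i < n)%N -> g i = h i) ->
     T g n = T h n) ->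
  exists g, T g = g.
Proof.
move=> Tcontr.
(* Iterating from 0, coefficient i is the same in all iterates after the i-th; the fixed point
   collects these stable values. *)
have itE i m n : (i < m)%N -> (i < n)%N -> iter m T 0 i = iter n T 0 i.
  have [N] := ubnP i; elim: N i m n => // N IH i [|m] [|n] //.
  rewrite ltnS => le_iN le_im le_in /=; apply: Tcontr => j lt_ji.
  by apply: IH; lia.
exists (Fps (fun n => iter n.+1 T 0 n)); apply/fpsP => n /=.
by apply: Tcontr => i lt_in /=; apply: (itE i i.+1).
Qed.

(** The inverse solves Y = v (1 - (X - X_0) Y). As X - X_0 has no constant term, the right side at
    index n sees only earlier coefficients of Y. *)
Lemma fps_inverse (A : comNzRingType) (v : A) (X : fps A) :
  v * X 0%N = 1 -> exists Y, X * Y = 1.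
Proof.
move=> vX.
have [|Y eY] := @fps_fixpoint A (fun Y => fpsC v * (1 - (X - fpsC (X 0%N)) * Y)).
  move=> n Y Y' YY'; rewrite 2!fps_coefCM 2!fps_coefB; congr (_ * (_ - _)).
  rewrite 2!fps_coefM !big_ord_recl fps_coefB /= subrr !mul0r; congr (_ + _).
  by apply: eq_bigr => i _; rewrite YY' // /bump leq0n; have := ltn_ord i; lia.
exists Y; have Cv : fpsC v * fpsC (X 0%N) = 1 by rewrite -rmorphM vX rmorph1.
have : Y - fpsC v * (1 - (X - fpsC (X 0%N)) * Y) = 0 by rewrite eY subrr.
move/(congr1 ( *%R (fpsC (X 0%N)))); rewrite mulr0 => e.
apply/eqP; rewrite -subr_eq0 -e; apply/eqP.
rewrite [RHS](_ : _ = fpsC (X 0%N) * Y * (1 - fpsC v * fpsC (X 0%N))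
  - (fpsC v * fpsC (X 0%N)) * (1 - X * Y)); last by ring.
by rewrite Cv; ring.
Qed.

(** * Derivations of a commutative ring *)

Section Derivation.
Context (A : comNzRingType) (D : A -> A).

(** Additivity and the Leibniz rule suffice for all differentiations below, so the same rules serve
    the derivatives in s, u, t^1, t^2 and t^3. *)
Definition derivation :=
  (forall X Y, D (X + Y) = D X + D Y) /\
  (forall X Y, D (X * Y) = D X * Y + X * D Y).

Hypothesis derD : derivation.

Lemma derivationD X Y : D (X + Y) = D X + D Y. Proof. exact: derD.1. Qed.
Lemma derivationM X Y : D (X * Y) = D X * Y + X * D Y. Proof. exact: derD.2. Qed.

Lemma derivation0 : D 0 = 0.
Proof. by apply: (addrI (D 0)); rewrite -derivationD !addr0. Qed.

Lemma derivationN X : D (- X) = - D X.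
Proof. by apply: (addrI (D X)); rewrite -derivationD !subrr derivation0. Qed.

Lemma derivationB X Y : D (X - Y) = D X - D Y.
Proof. by rewrite derivationD derivationN. Qed.

Lemma derivation1 : D 1 = 0.
Proof.
apply: (addrI (D 1)).
by rewrite -{1}[D 1]mulr1 -{2}[D 1]mul1r -derivationM mulr1 addr0.
Qed.

Lemma derivation_nat n : D n%:R = 0.
Proof.
elim: n => [|n IH]; first exact: derivation0.
by rewrite mulrS derivationD derivation1 IH addr0.
Qed.

Lemma derivationX X n : D (X ^+ n) = n%:R * X ^+ n.-1 * D X.
Proof.
elim: n => [|n IH]; first by rewrite expr0 derivation1 !mul0r.
rewrite exprS derivationM IH /=.
case: n {IH} => [|n] /=; first by rewrite expr0; ring.
by rewrite exprS (mulrS 1 n.+1); ring.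
Qed.

End Derivation.

Section FpsDerivation.
Context (A : comNzRingType).

Lemma fps_deriv_derivation : derivation (@fps_deriv A).
Proof.
split=> X Y; apply/fpsP => n; first by rewrite /= mulrnDl.
rewrite fps_coefD !fps_coefM /= fps_coefM.
(* The weight n+1 of the term X_i Y_(n+1-i) is split as i + (n+1-i), one share for each factor. *)
rewrite [X in _ = X + _](_ : _ =
  \sum_(i < n.+2) (X i * Y (n.+1 - i)%N) *+ i); last first.
  rewrite [RHS]big_ord_recl mulr0n add0r; apply: eq_bigr => i _.
  by rewrite lift0 /= mulrnAl subSS.
rewrite [X in _ = _ + X](_ : _ =
  \sum_(i < n.+2) (X i * Y (n.+1 - i)%N) *+ (n.+1 - i)); last first.
  rewrite [RHS]big_ord_recr /= subnn mulr0n addr0; apply: eq_bigr => i _.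
  have le_in : (i <= n)%N by rewrite -ltnS.
  by rewrite -mulrnAr subSn.
rewrite -big_split /= -sumrMnl; apply: eq_bigr => i _.
by rewrite -mulrnDr subnKC // -ltnS.
Qed.

Lemma fps_deriv_fpsC (c : A) : fps_deriv (fpsC c) = 0.
Proof. by apply/fpsP => n; rewrite fps_coef0 /= mul0rn. Qed.

Lemma fps_map_derivation (D : A -> A) : derivation D -> derivation (fps_map D).
Proof.
move=> dD; split=> X Y; apply/fpsP => n /=; first exact: dD.1.
rewrite !fps_coefM -big_split /=.
rewrite (big_morph D (derivationD dD) (derivation0 dD)).
by apply: eq_bigr => i _; rewrite derivationM.
Qed.

End FpsDerivation.

Section Lift.
Context (A B : comNzRingType) (f : {rmorphism A -> B}).

Definition fps_lift (X : fps A) : fps B := Fps (fun n => f (X n)).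

Fact fps_lift_zmod_morphism : zmod_morphism fps_lift.
Proof. by move=> X Y; apply/fpsP => n /=; rewrite rmorphB. Qed.

Fact fps_lift_monoid_morphism : monoid_morphism fps_lift.
Proof.
split=> [|X Y]; apply/fpsP => n.
  by case: n => [|n] /=; rewrite ?rmorph1 ?rmorph0.
by rewrite /= !fps_coefM rmorph_sum; apply: eq_bigr => i _; rewrite rmorphM.
Qed.

HB.instance Definition _ :=
  GRing.isZmodMorphism.Build (fps A) (fps B) fps_lift fps_lift_zmod_morphism.
HB.instance Definition _ :=
  GRing.isMonoidMorphism.Build (fps A) (fps B) fps_lift fps_lift_monoid_morphism.

Lemma fps_deriv_lift X : fps_deriv (fps_lift X) = fps_lift (fps_deriv X).
Proof. by apply/fpsP => n /=; rewrite rmorphMn. Qed.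

Lemma fps_lift_fpsC c : fps_lift (fpsC c) = fpsC (f c).
Proof. by apply/fpsP => -[|n] //=; rewrite rmorph0. Qed.

End Lift.

(** * Substitution of a series without constant term *)

Section Composition.
Context (K A : comNzRingType) (c : {rmorphism K -> A}) (X : fps A).
Hypothesis X0 : X 0%N = 0.
Implicit Types (f g : fps K) (Z : fps A).

Definition fps_comp f : fps A :=
  Fps (fun p => \sum_(n < p.+1) c (f n) * (X ^+ n) p).

(** Coefficient p of a composite depends only on a polynomial truncation of the outer series, so
    multiplicativity is inherited from evaluation of polynomials. *)
Let ev (P : {poly K}) : fps A := (map_poly (@fpsC A \o c) P).[X].

Let evE P p Z :
  (Z * ev P) p = \sum_(n < p.+1) c P`_n * (Z * X ^+ n) p.
Proof.
rewrite /ev (@horner_coef_wide _ (maxn p.+1 (size P))); last first.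
  by rewrite (leq_trans (size_poly _ _)) // leq_maxr.
rewrite mulr_sumr fps_coef_sum (big_ord_widen (maxn p.+1 (size P))
  (fun n => c P`_n * (Z * X ^+ n) p)) ?leq_maxl //.
rewrite [RHS]big_mkcond /=; apply: eq_bigr => i _.
rewrite coef_map /= mulrCA fps_coefCM; case: ltnP => // lt_pi.
rewrite [(Z * _) p](_ : _ = 0) ?mulr0 // fps_coefM big1 // => j _.
by rewrite fps_expX_coef ?mulr0 // (leq_ltn_trans (leq_subr _ _)).
Qed.

Let ev1E P p : ev P p = \sum_(n < p.+1) c P`_n * (X ^+ n) p.
Proof. by rewrite -[ev _]mul1r evE; under eq_bigr do rewrite mul1r. Qed.

Let comp_ev f N i : (i < N)%N -> fps_comp f i = ev (fps_trunc N f) i.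
Proof.
move=> lt_iN; rewrite ev1E; apply: eq_bigr => n _.
by rewrite coef_poly (leq_trans (ltn_ord n)).
Qed.

Lemma fps_mul_comp_coef Z f p :
  (Z * fps_comp f) p = \sum_(n < p.+1) c (f n) * (Z * X ^+ n) p.
Proof.
rewrite (@eq_fps_mul _ p Z Z (fps_comp f) (ev (fps_trunc p.+1 f))) // ?evE.
  by apply: eq_bigr => n _; rewrite coef_poly ltn_ord.
by move=> i le_ip; apply: comp_ev.
Qed.

Lemma fps_compD f g : fps_comp (f + g) = fps_comp f + fps_comp g.
Proof.
apply/fpsP => p /=; rewrite -big_split; apply: eq_bigr => n _.
by rewrite rmorphD mulrDl.
Qed.

Lemma fps_compN f : fps_comp (- f) = - fps_comp f.
Proof.
apply/fpsP => p /=; rewrite -sumrN; apply: eq_bigr => n _.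
by rewrite rmorphN mulNr.
Qed.

Lemma fps_compC a : fps_comp (fpsC a) = fpsC (c a).
Proof.
apply/fpsP => -[|p] /=; first by rewrite big_ord1 expr0 mulr1.
rewrite big_ord_recl /= mulr0 add0r big1 // => i _.
by rewrite rmorph0 mul0r.
Qed.

Lemma fps_compM f g : fps_comp (f * g) = fps_comp f * fps_comp g.
Proof.
apply/fpsP => p.
rewrite (@eq_fps_mul _ p _ (ev (fps_trunc p.+1 f)) _ (ev (fps_trunc p.+1 g)));
  try by (move=> * ; apply: comp_ev) || done.
rewrite [X in _ = fps_coef X p](_ : _ = ev (fps_trunc p.+1 f * fps_trunc p.+1 g)).
  rewrite ev1E /=; apply: eq_bigr => n _.
  by rewrite -(fps_mul_trunc _ _ (ltn_ord n)).
by rewrite /ev rmorphM hornerM.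
Qed.

Lemma fps_compX : fps_comp (fpsX K) = X.
Proof.
apply/fpsP => -[|p] /=; first by rewrite big_ord1 /= rmorph0 mul0r X0.
rewrite big_ord_recl /= rmorph0 mul0r add0r big_ord_recl /= rmorph1 mul1r expr1.
by rewrite big1 ?addr0 // => i _; rewrite rmorph0 mul0r.
Qed.

Lemma fps_comp0 f : fps_comp f 0%N = c (f 0%N).
Proof. by rewrite /= big_ord1 expr0 fps_coef1 mulr1. Qed.

End Composition.

(** * The reduced open WDVV equations *)

Section ReducedSystem.
Context (A : comNzRingType) (y Q R P : A).
Hypotheses (QR : Q * R = 1) (PQ : P * (3 * Q ^+ 2 - 1) = 1).

Let D := 3 * Q ^+ 2 - 1.
(** [E] stands for e^u (see [sol_E]) and [g] for Q x S; [U] and [W] are the numerators over 3 Q^2 -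
    1 of phi_uu and of - phi_ss. *)
Let E := 4 * y ^+ 2 + Q ^+ 2 * (1 - Q ^+ 2) ^+ 2.
Let g := Q ^+ 2 * (1 - Q ^+ 2).
Let U := y * Q * (2 * Q ^+ 2 - 1).
Let W := 4 * y * (E * R ^+ 3 - 4 * Q + 8 * Q ^+ 3).

(* As [P] inverts [3 Q^2 - 1], a polynomial in [P] vanishes as soon as its    *)
(* homogenization does.                                                       *)
Lemma homogenize l0 l1 l2 :
  l0 * (3 * Q ^+ 2 - 1) ^+ 2 + l1 * (3 * Q ^+ 2 - 1) + l2 = 0 ->
  l0 + P * l1 + P ^+ 2 * l2 = 0.
Proof.
move=> H; rewrite -[RHS](mulr0 (P ^+ 2)) -[in RHS]H.
have -> : P ^+ 2 * (l0 * (3 * Q ^+ 2 - 1) ^+ 2 + l1 * (3 * Q ^+ 2 - 1) + l2)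
  = l0 * (P * (3 * Q ^+ 2 - 1)) ^+ 2 + P * l1 * (P * (3 * Q ^+ 2 - 1))
    + P ^+ 2 * l2 by ring.
by rewrite PQ; ring.
Qed.

(* The values of 2 phi, phi_u, phi_uu, 2 phi_s, phi_su and phi_ss; phi and    *)
(* phi_s are doubled so that all coefficients are integers.                   *)
Definition sol2 := y * (R + 3 * Q).
Definition sol_u := y * Q.
Definition sol_uu := P * U.
Definition sol_s2 := - (E * R ^+ 2 + 4 * g).
Definition sol_su := - (g + P * (4 * y ^+ 2)).
Definition sol_ss := - (P * W).

Local Notation f2 := sol2.
Local Notation fu := sol_u.
Local Notation fuu := sol_uu.
Local Notation fs2 := sol_s2.
Local Notation fsu := sol_su.
Local Notation fss := sol_ss.

(** The suffixes 22s, 23s and 33s give (alpha, beta) in the second family of open WDVV equations;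
    223 and 323 come from the first family at (2,2,3) and (2,3,3). Each proof sorts the difference
    of the two sides by powers of [P] and clears [P], after which only Q R = 1 is needed. *)
Lemma sol_wdvv22s :
  4 * fsu - fs2 + (f2 - 9 * fu + 9 * fuu) * fss = (fs2 - 3 * fsu) ^+ 2.
Proof.
apply/eqP; rewrite -subr_eq0; apply/eqP.
rewrite [LHS](_ : _ = (- 4 * g - fs2 - (fs2 + 3 * g) ^+ 2)
  + P * (- 16 * y ^+ 2 - (f2 - 9 * fu) * W - 24 * y ^+ 2 * (fs2 + 3 * g))
  + P ^+ 2 * (- 9 * U * W - 144 * y ^+ 4)); last first.
  by rewrite /fsu /fss /fuu; ring.
by apply: homogenize; rewrite /fs2 /f2 /fu /W /U /E /g; ring: QR.
Qed.

Lemma sol_wdvv23s : E + (2 * fu - 3 * fuu) * fss = (fs2 - 3 * fsu) * fsu.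
Proof.
apply/eqP; rewrite -subr_eq0; apply/eqP.
rewrite [LHS](_ : _ = (E + (fs2 + 3 * g) * g)
  + P * (12 * y ^+ 2 * g + 4 * y ^+ 2 * (fs2 + 3 * g) - 2 * fu * W)
  + P ^+ 2 * (48 * y ^+ 4 + 3 * U * W)); last first.
  by rewrite /fsu /fss /fuu; ring.
by apply: homogenize; rewrite /fs2 /f2 /fu /W /U /E /g; ring: QR.
Qed.

Lemma sol_wdvv33s : E * (1 + fs2 - 3 * fsu) + fuu * fss = fsu ^+ 2.
Proof.
apply/eqP; rewrite -subr_eq0; apply/eqP.
rewrite [LHS](_ : _ = (E * (1 + fs2 + 3 * g) - g ^+ 2)
  + P * (12 * E * y ^+ 2 - 8 * y ^+ 2 * g)
  + P ^+ 2 * (- U * W - 16 * y ^+ 4)); last first.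
  by rewrite /fsu /fss /fuu; ring.
by apply: homogenize; rewrite /fs2 /f2 /fu /W /U /E /g; ring: QR.
Qed.

Lemma sol_wdvv223 : fuu - (2 * fu - 3 * fuu) + (f2 - 9 * fu + 9 * fuu) * fsu
  = (2 * fu - 3 * fuu) * (fs2 - 3 * fsu).
Proof.
apply/eqP; rewrite -subr_eq0; apply/eqP.
rewrite [LHS](_ : _ = (- 2 * fu - (f2 - 9 * fu) * g - 2 * fu * (fs2 + 3 * g))
  + P * (4 * U - (f2 - 9 * fu) * (4 * y ^+ 2) - 9 * U * g
         - 24 * fu * y ^+ 2 + 3 * U * (fs2 + 3 * g))
  + P ^+ 2 * 0); last first.
  by rewrite /fsu /fss /fuu; ring.
by apply: homogenize; rewrite /fs2 /f2 /fu /W /U /E /g; ring: QR.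
Qed.

Lemma sol_wdvv323 : 2 * fu * fsu - fuu * fs2 = E * (f2 - 9 * fu + 9 * fuu).
Proof.
apply/eqP; rewrite -subr_eq0; apply/eqP.
rewrite [LHS](_ : _ = (- 2 * fu * g - E * (f2 - 9 * fu))
  + P * (- 8 * fu * y ^+ 2 - U * fs2 - 9 * E * U)
  + P ^+ 2 * 0); last first.
  by rewrite /fsu /fss /fuu; ring.
by apply: homogenize; rewrite /fs2 /f2 /fu /W /U /E /g; ring: QR.
Qed.

End ReducedSystem.

(** * Derivatives of the closed form *)

Section SolutionDerivatives.
Context (A : comNzRingType) (Du Ds : A -> A) (h x S C y Q R P : A).
Hypotheses (dDu : derivation Du) (dDs : derivation Ds) (h2 : 2 * h = 1).
Hypotheses (Du_x : Du x = h * x) (Ds_x : Ds x = 0).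
Hypotheses (Du_S : Du S = 0) (Du_C : Du C = 0).
Hypotheses (Ds_S : Ds S = 2 * C) (Ds_C : Ds C = - 2 * S).
Hypotheses (SC : S ^+ 2 + C ^+ 2 = 1) (Q3 : Q ^+ 3 = Q - x * S).
Hypotheses (QR : Q * R = 1) (PQ : P * (3 * Q ^+ 2 - 1) = 1).

Hypothesis yE : y = h * x * C.
Definition sol := h * y * (R + 3 * Q).

Let h2_mul z : 2 * h * z = z. Proof. by rewrite h2 mul1r. Qed.
Let PQ_mul z : P * (3 * Q ^+ 2 - 1) * z = z. Proof. by rewrite PQ mul1r. Qed.
Let QR_mul z : Q * R * z = z. Proof. by rewrite QR mul1r. Qed.

Let h_const D : derivation D -> D h = 0.
Proof.
move=> dD; rewrite -[D h]h2_mul -mulrA mulrCA.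
have <- : D (2 * h) = 2 * D h.
  by rewrite (derivationM dD) // (derivation_nat dD 2) mul0r add0r.
by rewrite h2 (derivation1 dD) ?mulr0.
Qed.

Let xS : x * S = Q - Q ^+ 3. Proof. by rewrite Q3; ring. Qed.

(** Implicit differentiation of the cubic gives (3 Q^2 - 1) D Q = - D(x S), and [P] inverts the
    factor on the left. *)
Let D_Q D : derivation D -> D Q = - P * D (x * S).
Proof.
move=> dD; have := congr1 D Q3; rewrite (derivationX dD) (derivationB dD) => e.
rewrite -[LHS]PQ_mul [D (x * S)](_ : _ = D Q - 3 * Q ^+ 2 * D Q).
  by ring.
by rewrite e; ring.
Qed.

Let D_R D : derivation D -> D R = - R ^+ 2 * D Q.
Proof.
move=> dD; have := congr1 D QR; rewrite (derivationM dD) (derivation1 dD) => e.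
rewrite [LHS](_ : _ = R * (D Q * R + Q * D R) - R ^+ 2 * D Q); last first.
  by rewrite -[LHS]QR_mul; ring.
by rewrite e; ring.
Qed.

Let Du_y : Du y = h * y.
Proof. by rewrite yE !(derivationM dDu) (h_const dDu) Du_x Du_C; ring. Qed.

Let Ds_y : Ds y = - (Q - Q ^+ 3).
Proof.
rewrite yE !(derivationM dDs) (h_const dDs) Ds_x Ds_C -xS.
by rewrite -[RHS]h2_mul; ring.
Qed.

Let Du_Q : Du Q = - P * h * (Q - Q ^+ 3).
Proof. by rewrite (D_Q dDu) (derivationM dDu) // Du_x Du_S -xS; ring. Qed.

Let Ds_Q : Ds Q = - 4 * y * P.
Proof.
rewrite (D_Q dDs) (derivationM dDs) // Ds_x Ds_S yE.
by rewrite -[LHS]h2_mul; ring.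
Qed.

(** Multiply S^2 + C^2 = 1 by x^2 and use x C = 2 y and x S = Q - Q^3. *)
Lemma sol_E : x ^+ 2 = 4 * y ^+ 2 + Q ^+ 2 * (1 - Q ^+ 2) ^+ 2.
Proof.
rewrite (_ : Q ^+ 2 * _ = (x * S) ^+ 2); last by rewrite xS; ring.
rewrite (_ : 4 * y ^+ 2 = (2 * h) ^+ 2 * (x * C) ^+ 2); last by rewrite yE; ring.
by rewrite h2 -[LHS]mulr1 -[X in _ * X]SC; ring.
Qed.

Lemma sol_2E : 2 * sol = sol2 y Q R.
Proof. by rewrite /sol /sol2 -[RHS]h2_mul; ring. Qed.

Lemma Du_solE : Du sol = sol_u y Q.
Proof.
(* With R + 3 Q = (R - Q) + 4 Q, this is the part of phi_u that cancels; the 4 Q leaves y Q. *)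
have Q4 : (R - Q) + P * (R - 4 * Q + 3 * Q ^+ 3) + P ^+ 2 * 0 = 0.
  by apply: (homogenize PQ); ring: QR.
rewrite /sol !(derivationM dDu) (derivationD dDu) (derivationM dDu) (h_const dDu).
rewrite (derivation_nat dDu 3) Du_y (D_R dDu) Du_Q.
rewrite [LHS](_ : _ = h ^+ 2 * y * ((R - Q) + P * (R - 4 * Q + 3 * Q ^+ 3)
  + P ^+ 2 * 0) + (2 * h) ^+ 2 * y * Q); last by ring: QR.
by rewrite Q4 h2 /sol_u; ring.
Qed.

Lemma Ds_solE : 2 * Ds sol = sol_s2 y Q R.
Proof.
have Q4 : (- (Q - Q ^+ 3) * (R + 3 * Q) - sol_s2 y Q R)
  + P * (4 * y ^+ 2 * (R ^+ 2 - 3)) + P ^+ 2 * 0 = 0.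
  by apply: (homogenize PQ); rewrite /sol_s2; ring: QR.
rewrite /sol !(derivationM dDs) (derivationD dDs) (derivationM dDs) (h_const dDs).
rewrite (derivation_nat dDs 3) Ds_y (D_R dDs) Ds_Q.
rewrite [LHS](_ : _ = (2 * h) * ((- (Q - Q ^+ 3) * (R + 3 * Q) - sol_s2 y Q R)
  + P * (4 * y ^+ 2 * (R ^+ 2 - 3)) + P ^+ 2 * 0) + (2 * h) * sol_s2 y Q R).
  by rewrite Q4 h2; ring.
by ring.
Qed.

Lemma Duu_solE : Du (Du sol) = sol_uu y Q P.
Proof.
have Q4 : Q + P * (- (Q - Q ^+ 3) - 2 * Q * (2 * Q ^+ 2 - 1)) + P ^+ 2 * 0 = 0.
  by apply: (homogenize PQ); ring.
rewrite Du_solE /sol_u (derivationM dDu) // Du_y Du_Q -[RHS]h2_mul /sol_uu.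
apply/eqP; rewrite -subr_eq0; apply/eqP; rewrite -[RHS](mulr0 (h * y)) -[in RHS]Q4.
by ring.
Qed.

Lemma Dsu_solE : Ds (Du sol) = sol_su y Q P.
Proof. by rewrite Du_solE /sol_u (derivationM dDs) // Ds_y Ds_Q /sol_su; ring. Qed.

Lemma Dss_solE : Ds (Ds sol) = sol_ss y Q R P.
Proof.
have e : 2 * Ds (Ds sol) = 2 * sol_ss y Q R P.
  have -> : 2 * Ds (Ds sol) = Ds (2 * Ds sol).
    by rewrite (derivationM dDs 2) (derivation_nat dDs 2) mul0r add0r.
  (* With e^u written as x^2, a constant for [Ds], only Q and R remain to be differentiated. *)
  rewrite Ds_solE /sol_s2 /sol_ss -sol_E !(derivationN dDs, derivationD dDs,
    derivationB dDs, derivationM dDs, derivationX dDs, derivation1 dDs).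
  by rewrite Ds_x (D_R dDs) Ds_Q; ring.
by rewrite -[LHS]h2_mul -[RHS]h2_mul mulrAC [RHS]mulrAC e.
Qed.

End SolutionDerivatives.

(** * Exponential and trigonometric series *)

Section Exponential.
Context (K : numFieldType).
Implicit Types a b c : K.

Lemma factR_neq0 n : n`!%:R != 0 :> K.
Proof. by rewrite pnatr_eq0 -lt0n fact_gt0. Qed.

Lemma fpsC_half : 2 * fpsC (1 / 2) = 1 :> fps K.
Proof.
rewrite -(rmorph_nat (@fpsC K) 2) -rmorphM -(rmorph1 (@fpsC K)).
by congr fpsC; field.
Qed.

Definition fexp c : fps K := Fps (fun n => c ^+ n / n`!%:R).

Lemma fexpD a b : fexp (a + b) = fexp a * fexp b.
Proof.
apply/fpsP => n; rewrite fps_coefM /= addrC exprDn mulr_suml.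
apply: eq_bigr => i _; have le_in : (i <= n)%N by rewrite -ltnS.
rewrite -mulr_natr -(bin_fact le_in) !natrM.
have := factR_neq0 i; have := factR_neq0 (n - i).
have : ('C(n, i)%:R : K) != 0 by rewrite pnatr_eq0 -lt0n bin_gt0.
by move=> ? ? ?; field; apply/and3P.
Qed.

Lemma fexp0 : fexp 0 = 1.
Proof.
by apply/fpsP => -[|n] /=; rewrite ?expr0 ?divr1 // expr0n mul0r.
Qed.

Lemma fexpX c n : fexp c ^+ n = fexp (n%:R * c).
Proof.
elim: n => [|n IH]; first by rewrite mul0r fexp0.
by rewrite exprS IH -fexpD mulrS mulrDl mul1r.
Qed.

Lemma fps_deriv_fexp c : fps_deriv (fexp c) = fpsC c * fexp c.
Proof.
apply/fpsP => n; rewrite fps_coefCM /= -[LHS]mulr_natr exprS factS natrM.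
have n1 : n.+1%:R != 0 :> K by rewrite pnatr_eq0.
have := factR_neq0 n; move: (n`!%:R) (n.+1%:R) n1 => f m m0 f0.
by field; apply/andP.
Qed.

End Exponential.

(** * Sine and cosine series, and powers of sines as multiple angles *)

Section Trigonometric.
Context (K : numClosedFieldType).
Implicit Types a b : K.

Local Notation h := (fpsC (1 / 2) : fps K).
Local Notation I := (fpsC 'i : fps K).
Local Notation E a := (fexp ('i * a)).

Definition fcos a : fps K := h * (E a + E (- a)).
Definition fsin a : fps K := - (h * I) * (E a - E (- a)).

Let twoh (z : fps K) : 2 * h * z = z.
Proof. by rewrite fpsC_half mul1r. Qed.

Let II : I ^+ 2 = - 1.
Proof. by rewrite -rmorphXn /= sqrCi rmorphN1. Qed.

Let EN a : E a * E (- a) = 1.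
Proof. by rewrite -fexpD mulrN subrr fexp0. Qed.

Let ED a b : E (a + b) = E a * E b.
Proof. by rewrite mulrDr fexpD. Qed.

Lemma fcosN a : fcos (- a) = fcos a.
Proof. by rewrite /fcos opprK addrC. Qed.

Lemma fsin0 : fsin 0 = 0.
Proof. by rewrite /fsin oppr0 subrr mulr0. Qed.

Lemma fcos_mul_fcos a b : fcos a * fcos b = h * (fcos (a + b) + fcos (a - b)).
Proof. by rewrite /fcos !opprD opprK !ED; ring. Qed.

Lemma fsin_mul_fcos a b : fsin a * fcos b = h * (fsin (a + b) + fsin (a - b)).
Proof. by rewrite /fsin /fcos !opprD opprK !ED; ring. Qed.

Lemma fcos2D_fsin2 a : fsin a ^+ 2 + fcos a ^+ 2 = 1.
Proof.
rewrite [LHS](_ : _ = I ^+ 2 * (h * (E a - E (- a))) ^+ 2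
  + (h * (E a + E (- a))) ^+ 2).
  rewrite II [LHS](_ : _ = (2 * h) ^+ 2 * (E a * E (- a))); last by ring.
  by rewrite fpsC_half EN mulr1 expr1n.
by rewrite /fsin /fcos; ring.
Qed.

Lemma fsin_sqr a : fsin a ^+ 2 = h * (1 - fcos (a + a)).
Proof.
have := fcos2D_fsin2 a; rewrite [X in _ + X]expr2 fcos_mul_fcos subrr.
have -> : fcos 0 = 1 by rewrite /fcos oppr0 mulr0 fexp0 -[RHS]twoh; ring.
move/eqP; rewrite eq_sym -subr_eq => /eqP <-.
rewrite -{1}[1]twoh; ring.
Qed.

Lemma fps_deriv_fsin a : fps_deriv (fsin a) = fpsC a * fcos a.
Proof.
rewrite /fsin -rmorphM -rmorphN; apply/fpsP => n.
rewrite [LHS]/= !fps_coefCM -!mulrnAr -[X in _ * X]/(fps_deriv (E a - E (- a)) n).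
rewrite (derivationB (@fps_deriv_derivation K)) !fps_deriv_fexp.
rewrite fps_coefB fps_coefD !fps_coefCM.
rewrite [RHS](_ : _ = - (1 / 2) * ('i ^+ 2) * a * (E a n + E (- a) n)).
  by ring.
by rewrite sqrCi; ring.
Qed.

Lemma fps_deriv_fcos a : fps_deriv (fcos a) = - (fpsC a * fsin a).
Proof.
rewrite /fcos; apply/fpsP => n.
rewrite [LHS]/= !fps_coefCM -!mulrnAr -[X in _ * X]/(fps_deriv (E a + E (- a)) n).
rewrite (derivationD (@fps_deriv_derivation K)) !fps_deriv_fexp.
rewrite fps_coefN fps_coefD /fsin -rmorphM -rmorphN !fps_coefCM.
by rewrite fps_coefB; ring.
Qed.

Lemma fsin_coef_even a k : fsin a (2 * k)%N = 0.
Proof.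
rewrite /fsin -rmorphM -rmorphN fps_coefCM /=.
by rewrite mulrN (exprM (- ('i * a))) sqrrN -exprM subrr mulr0.
Qed.

Lemma fcos_coef_odd a k : fcos a (2 * k + 1)%N = 0.
Proof.
rewrite /fcos fps_coefCM /= addn1 exprS mulrN exprS.
rewrite (exprM (- ('i * a))) sqrrN -exprM.
by ring.
Qed.

Lemma fcos_coef_even a k :
  fcos a (2 * k)%N = (-1) ^+ k * a ^+ (2 * k) / (2 * k)`!%:R.
Proof.
rewrite /fcos fps_coefCM /= mulrN (exprM (- ('i * a))) sqrrN -exprM.
rewrite exprMn (exprM 'i) sqrCi; field.
exact: factR_neq0.
Qed.

Lemma fsin_coef_odd a k :
  fsin a (2 * k + 1)%N = (-1) ^+ k * a ^+ (2 * k + 1) / (2 * k + 1)`!%:R.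
Proof.
have sgn : (-1) ^+ (2 * k + 1) = -1 :> K.
  by rewrite exprD exprM sqrrN !expr1n mul1r.
rewrite /fsin -rmorphM -rmorphN fps_coefCM /= mulrN (exprNn ('i * a)) sgn.
rewrite exprMn (exprD 'i) (exprM 'i) sqrCi expr1.
set c := (-1) ^+ k.
rewrite [LHS](_ : _ = - 'i ^+ 2 * c * (a ^+ (2 * k + 1) / (2 * k + 1)`!%:R)).
  by rewrite sqrCi; ring.
by field; exact: factR_neq0.
Qed.

Definition spanned (v : nat -> fps K) n (X : fps K) :=
  exists c : nat -> K, X = \sum_(1 <= i < n.+1) fpsC (c i) * v i.

Lemma spannedD v n X Y : spanned v n X -> spanned v n Y -> spanned v n (X + Y).
Proof.
move=> [c ->] [c' ->]; exists (fun i => c i + c' i); rewrite -big_split /=.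
by apply: eq_bigr => i _; rewrite rmorphD mulrDl.
Qed.

Lemma spannedZ v n a X : spanned v n X -> spanned v n (fpsC a * X).
Proof.
move=> [c ->]; exists (fun i => a * c i); rewrite mulr_sumr.
by apply: eq_bigr => i _; rewrite rmorphM mulrA.
Qed.

Lemma spanned0 v n : spanned v n 0.
Proof. by exists (fun=> 0); rewrite big1 // => i _; rewrite rmorph0 mul0r. Qed.

Lemma spanned_gen v n i : (0 < i <= n)%N -> spanned v n (v i).
Proof.
move=> /andP[i_gt0 le_in]; exists (fun j => (j == i)%:R).
rewrite (bigD1_seq i) ?mem_index_iota ?iota_uniq ?i_gt0 //= eqxx rmorph1 mul1r.
by rewrite big1 ?addr0 // => j /negbTE ->; rewrite rmorph0 mul0r.
Qed.

Lemma spanned_sum v n (r : seq nat) (c : nat -> K) w :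
  (forall i, i \in r -> spanned v n (w i)) ->
  spanned v n (\sum_(i <- r) fpsC (c i) * w i).
Proof.
move=> vw; rewrite big_seq; elim/big_rec: _ => [|i X /vw wi IH].
  exact: spanned0.
by apply: spannedD IH; apply: spannedZ.
Qed.

(** Two more factors sin 2s are (1 - cos 4s)/2, which sends the frequency 4i to 4i, 4i + 4 and 4i -
    4. For i = 1 the last one is 0, and its sine vanishes. *)
Lemma fcos_mul_fsin_odd j :
  spanned (fun i => fsin (4 * i%:R)) j.+1 (fcos 2 * fsin 2 ^+ (2 * j).+1).
Proof.
elim: j => [|j [c IH]].
  exists (fun=> 1 / 2); rewrite big_nat1 muln0 expr1 mulrC fsin_mul_fcos subrr.
  by rewrite fsin0 addr0; congr (_ * fsin _); ring.
rewrite mulnS -addnS exprD mulrCA mulrC IH mulr_suml.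
under eq_bigr do rewrite -mulrA.
apply: spanned_sum => i; rewrite mem_index_iota => /andP[i_gt0 le_ij].
rewrite fsin_sqr mulrCA; apply: spannedZ; rewrite mulrBr mulr1.
rewrite fsin_mul_fcos -mulNr -rmorphN.
apply: spannedD; first by apply: spanned_gen; lia.
apply: spannedZ; apply: spannedD.
  rewrite (_ : _ + _ = 4 * i.+1%:R); last by rewrite (mulrS _ i); ring.
  by apply: spanned_gen; lia.
rewrite (_ : _ - _ = 4 * i.-1%:R); last by rewrite -{1}(prednK i_gt0) mulrS; ring.
case: i i_gt0 le_ij => // -[|i] _ le_ij.
  by rewrite mulr0 fsin0; exact: spanned0.
by apply: spanned_gen; lia.
Qed.

(** The same induction on frequencies 4i - 2. For i = 1 the lowered frequency is -2, which evenness
    of the cosine turns into 2. *)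
Lemma fcos_mul_fsin_even j :
  spanned (fun i => fcos (4 * i%:R - 2)) j.+1 (fcos 2 * fsin 2 ^+ (2 * j)).
Proof.
elim: j => [|j [c IH]].
  exists (fun=> 1); rewrite big_nat1 muln0 expr0 mulr1 rmorph1 mul1r.
  by congr fcos; ring.
rewrite mulnS exprD mulrCA mulrC IH mulr_suml.
under eq_bigr do rewrite -mulrA.
apply: spanned_sum => i; rewrite mem_index_iota => /andP[i_gt0 le_ij].
rewrite fsin_sqr mulrCA; apply: spannedZ; rewrite mulrBr mulr1.
rewrite fcos_mul_fcos -mulNr -rmorphN.
apply: spannedD; first by apply: spanned_gen; lia.
apply: spannedZ; apply: spannedD.
  rewrite (_ : _ + (2 + 2) = 4 * i.+1%:R - 2); last by rewrite (mulrS _ i); ring.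
  by apply: spanned_gen; lia.
case: i i_gt0 le_ij => // -[|i] _ le_ij.
  rewrite -fcosN (_ : - (_ - (2 + 2)) = 4 * 1%:R - 2); last by ring.
  exact: (@spanned_gen (fun i => fcos (4 * i%:R - 2)) _ 1%N).
rewrite (_ : _ - (2 + 2) = 4 * i.+1%:R - 2); last by rewrite !mulrS; ring.
by apply: spanned_gen; lia.
Qed.

End Trigonometric.

(** With q = 1 + X w, dividing the cubic by X leaves 2 w = - (1 + X (3 w^2 + X w^3)). Solved for w,
    this has a factor X in front of every occurrence of w on the right, so it is a fixed-point
    equation. *)
Lemma cubic_series (K : numFieldType) : exists q r : fps K,
  [/\ q 0%N = 1, q * r = 1 & q ^+ 3 = q - fpsX K].
Proof.
pose X := fpsX K; pose h : fps K := fpsC (1 / 2).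
have hX (g g' : fps K) n :
    (forall i, (i < n)%N -> g i = g' i) -> (X * g) n = (X * g') n.
  case: n => [|n] gg'; first by rewrite !fps_coefXM0.
  by rewrite !fps_coefXMS gg'.
have h2 : 2 * h = 1 by apply: fpsC_half.
(* q = 1 + X w *)
have [|w ew] := @fps_fixpoint K
  (fun w => - h + X * (- h * (3 * w ^+ 2 + X * w ^+ 3))).
  move=> n g g' gg'; rewrite 2!fps_coefD; congr (_ + _); apply: hX => i lt_in.
  have E j : (j <= i)%N -> g j = g' j by move=> ?; apply: gg'; lia.
  have E2 j : (j <= i)%N -> (g ^+ 2) j = (g' ^+ 2) j by apply: eq_fps_mul.
  have E3 j : (j <= i)%N -> (g ^+ 3) j = (g' ^+ 3) j.
    by rewrite !(exprS _ 2); apply: eq_fps_mul.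
  apply: (@eq_fps_mul _ i) => // j le_ji; rewrite 2!fps_coefD; congr (_ + _).
    by apply: (@eq_fps_mul _ i) => //.
  by apply: (@eq_fps_mul _ i).
have [|r er] := @fps_inverse K 1 (1 + X * w).
  by rewrite fps_coefD fps_coefXM0 addr0 mulr1.
exists (1 + X * w), r; split.
- by rewrite fps_coefD fps_coefXM0 addr0.
- by [].
have e2 : 2 * w = - (1 + X * (3 * w ^+ 2 + X * w ^+ 3)).
  rewrite -{1}ew [LHS](_ : _ = - (2 * h) * (1 + X * (3 * w ^+ 2 + X * w ^+ 3))).
    by rewrite h2 mulN1r.
  by ring.
have e3 := congr1 ( *%R X) e2; rewrite -/X; apply/eqP; rewrite -subr_eq0; apply/eqP.
rewrite [LHS](_ : _ = X * (2 * w) + X + X ^+ 2 * (3 * w ^+ 2 + X * w ^+ 3)).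
  by rewrite e3; ring.
by ring.
Qed.

(** * The closed-form solution *)

Section Solution.
Context (K : numClosedFieldType) (q r : fps K).
Hypotheses (q0 : q 0%N = 1) (qr : q * r = 1) (q3 : q ^+ 3 = q - fpsX K).

Local Notation S1 := (fps K).
Local Notation S2 := (fps (fps K)).

(* In [fps (fps K)], the outer variable is [s] and the inner one is [u]. *)
Definition pd_u : S2 -> S2 := fps_map (@fps_deriv K).
Definition pd_s : S2 -> S2 := @fps_deriv (fps K).

Lemma pd_u_derivation : derivation pd_u.
Proof. exact: (fps_map_derivation (@fps_deriv_derivation K)). Qed.

Lemma pd_s_derivation : derivation pd_s.
Proof. exact: fps_deriv_derivation. Qed.

Lemma pd_suC X : pd_s (pd_u X) = pd_u (pd_s X).
Proof.
by apply/fpsP => n; apply/fpsP => m /=; rewrite !fps_coefMn -!mulrnA mulnC.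
Qed.

Definition in_s : S1 -> S2 := fps_lift (@fpsC K).

Let hh : S2 := fpsC (fpsC (1 / 2)).
Let x : S2 := fpsC (fexp (1 / 2)).
Let S := in_s (fsin 2).
Let C := in_s (fcos 2).
Let y := hh * x * C.
Let X := x * S.

Let X0 : X 0%N = 0.
Proof. by rewrite fps_coefM0 /= -(muln0 2) fsin_coef_even rmorph0 mulr0. Qed.

Let comp := fps_comp (@fpsC K) X.
Let Q := comp q.
Let R := comp r.

Definition open_sol : S2 := sol hh y Q R.

Let hh2 : 2 * hh = 1.
Proof.
by rewrite /hh -(rmorph_nat (@fpsC S1) 2) -rmorphM fpsC_half rmorph1.
Qed.

Let Q3 : Q ^+ 3 = Q - X.
Proof.
rewrite /Q /comp !exprS expr0 mulr1 -!(fps_compM _ X0) -expr2 -exprS q3.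
by rewrite fps_compD fps_compN (fps_compX _ X0).
Qed.

Let QR : Q * R = 1.
Proof.
by rewrite /Q /R /comp -(fps_compM _ X0) qr [1]/(fpsC 1) fps_compC rmorph1.
Qed.

(** As X has no constant term in s, Q starts with 1, so 3 Q^2 - 1 starts with 2, which is
    invertible. *)
Let P_ex : exists P, P * (3 * Q ^+ 2 - 1) = 1.
Proof.
have [|P eP] := @fps_inverse _ (fpsC (1 / 2)) (3 * Q ^+ 2 - 1).
  rewrite fps_coefB !fps_coefM0 [Q _]fps_comp0 q0 rmorph1.
  rewrite -(rmorph_nat (@fpsC S1) 3) /= mulrC [X in X * _](_ : _ = 2).
    exact: fpsC_half.
  by ring.
by exists P; rewrite mulrC.
Qed.

Let xE : pd_u x = hh * x.
Proof.
apply/fpsP => -[|n]; rewrite fps_coefCM /=; first by rewrite fps_deriv_fexp.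
by rewrite mulr0 (derivation0 (@fps_deriv_derivation K)).
Qed.

Let pd_u_in_s f : pd_u (in_s f) = 0.
Proof.
apply/fpsP => n; rewrite fps_coef0; apply/fpsP => m.
by rewrite fps_coef0 /= mul0rn.
Qed.

Let pd_s_x : pd_s x = 0.
Proof. by apply/fpsP => n; rewrite fps_coef0 /= mul0rn. Qed.

Let pd_s_S : pd_s S = 2 * C.
Proof.
rewrite /pd_s /S /in_s fps_deriv_lift fps_deriv_fsin rmorphM.
by rewrite !rmorph_nat.
Qed.

Let pd_s_C : pd_s C = - 2 * S.
Proof.
rewrite /pd_s /C /in_s fps_deriv_lift fps_deriv_fcos rmorphN rmorphM.
by rewrite !rmorph_nat mulNr.
Qed.

Let SC : S ^+ 2 + C ^+ 2 = 1.
Proof. by rewrite /S /C /in_s -!rmorphXn -rmorphD fcos2D_fsin2 rmorph1. Qed.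

Let x2 : x ^+ 2 = fpsC (fexp 1).
Proof.
rewrite /x -rmorphXn fexpX; congr (fpsC (fexp _)); first by field.
Qed.

Local Notation phi := open_sol.
Local Notation E := (fpsC (fexp 1)).

Lemma open_solP : let fu := pd_u phi in let fuu := pd_u fu in
  let fs := pd_s phi in let fsu := pd_u fs in let fss := pd_s fs in
  [/\ 4 * fsu - 2 * fs + (2 * phi - 9 * fu + 9 * fuu) * fss
        = (2 * fs - 3 * fsu) ^+ 2,
      E + (2 * fu - 3 * fuu) * fss = (2 * fs - 3 * fsu) * fsu,
      E * (1 + 2 * fs - 3 * fsu) + fuu * fss = fsu ^+ 2,
      fuu - (2 * fu - 3 * fuu) + (2 * phi - 9 * fu + 9 * fuu) * fsu
        = (2 * fu - 3 * fuu) * (2 * fs - 3 * fsu) &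
      2 * fu * fsu - fuu * (2 * fs) = E * (2 * phi - 9 * fu + 9 * fuu)].
Proof.
have [P PQ] := P_ex.
have yE : y = hh * x * C by [].
move=> fu fuu fs fsu fss.
have -> : fsu = sol_su y Q P.
  rewrite /fsu /fs -pd_suC.
  exact: (Dsu_solE pd_u_derivation pd_s_derivation hh2 xE pd_s_x
    (pd_u_in_s _) (pd_u_in_s _) pd_s_S pd_s_C Q3 QR PQ yE).
have -> : fuu = sol_uu y Q P.
  exact: (Duu_solE pd_u_derivation hh2 xE
    (pd_u_in_s _) (pd_u_in_s _) Q3 QR PQ yE).
have -> : fu = sol_u y Q.
  exact: (Du_solE pd_u_derivation hh2 xE
    (pd_u_in_s _) (pd_u_in_s _) Q3 QR PQ yE).
have -> : fss = sol_ss y Q R P.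
  exact: (Dss_solE pd_s_derivation hh2 pd_s_x pd_s_S pd_s_C SC Q3 QR PQ yE).
have -> : 2 * fs = sol_s2 y Q R.
  exact: (Ds_solE pd_s_derivation hh2 pd_s_x pd_s_S pd_s_C Q3 QR PQ yE).
have -> : 2 * phi = sol2 y Q R by exact: sol_2E.
rewrite -x2 (sol_E hh2 SC Q3 yE); split.
- exact: sol_wdvv22s.
- exact: sol_wdvv23s.
- exact: sol_wdvv33s.
- exact: sol_wdvv223.
- exact: sol_wdvv323.
Qed.

(** Expand (1/Q + 3 Q)/4 in powers of x S. S has no constant term, so only n <= p reach s^p, and the
    n-th term carries x^(n+1) = e^((n+1) u / 2). *)
Lemma open_sol_coef p : phi p = \sum_(n < p.+1)
  fpsC ((1 / 4) * (r + q *+ 3) n * (fcos 2 * fsin 2 ^+ n) p)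
  * fexp (n.+1%:R / 2).
Proof.
have -> : phi = (x * C) * comp (fpsC (1 / 4) * (r + q *+ 3)).
  rewrite /comp (fps_compM _ X0) fps_compC fps_compD !(mulrS q) mulr0n addr0.
  rewrite !fps_compD -/comp -/Q -/R [fpsC (fpsC (1 / 4))](_ : _ = hh * hh).
    by rewrite /open_sol /sol /y; ring.
  by rewrite /hh -!rmorphM; congr (fpsC (fpsC _)); field.
rewrite (fps_mul_comp_coef _ X0); apply: eq_bigr => n _.
rewrite fps_coefCM /X exprMn mulrACA -exprS /x -rmorphXn fexpX.
rewrite fps_coefCM /C /S /in_s -rmorphXn -rmorphM /=.
by rewrite rmorphM mulrCA mulrA [RHS]mulrC mulrA [X in fexp X]mulrA mulr1; ring.
Qed.

End Solution.

(** * The recursion relations *)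

Section RecursionTerms.
Context (K : numClosedFieldType).
Implicit Types (b d : nat -> nat -> K) (p q k i j m n r t : nat).

Lemma zpowN (x : K) (z : int) : x ^ (- z) = (x ^ z)^-1.
Proof. by rewrite invr_expz. Qed.

Lemma zpowMn (x : K) (a v : nat) : x ^ (a%:R * v%:Z) = (x ^+ v) ^+ a.
Proof. by rewrite natz -PoszM -exprM mulnC. Qed.

Lemma zpowR (x : K) (a : nat) : x ^ (a%:R : int) = x ^+ a.
Proof. by rewrite natz. Qed.

Lemma two_neq0 : 2 != 0 :> K. Proof. by rewrite pnatr_eq0. Qed.

(** These regroup [a_coef]: in the sum over q, the powers j^q / q! and ((2j-1)/2)^q / q! assemble
    into e^(j u) and e^((2j-1) u / 2). A scale depends on p only; a weight is the factor multiplying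
    a single number b or d. *)
Definition b_scale k : K := (-1) ^+ k * 2 ^ (4 * k%:Z - 4) / (2 * k + 1)`!%:R.
Definition d_scale k : K := (-1) ^+ k * 2 / (2 * k)`!%:R.
Definition b_weight k i j : K := i%:R ^ (2 * k%:Z - 2 * j%:Z + 4).
Definition d_weight k i j : K :=
  (-1) ^+ (i + 1) * (4 * i%:R - 2) ^ (2 * k%:Z - 2 * j%:Z + 4).
Definition half_odd r : K := (2 * r%:R - 1) / 2.

Lemma four_sub2 m : 4 * m%:R - 2 = 2 * (2 * m%:R - 1) :> K.
Proof. by ring. Qed.

Lemma half_odd1 : half_odd 1 = 2^-1.
Proof. by rewrite /half_odd; field. Qed.

Lemma exprz16 (z : int) : 16 ^ z = 2 ^ (4 * z) :> K.
Proof. by rewrite -exprz_exp; congr (_ ^ _); rewrite -[4]/(4%:Z) -exprnP; ring. Qed.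

Lemma fact2S i : (2 * i + 2)`! = (2 * (i + 1))`!.
Proof. by rewrite mulnDr. Qed.

(** Exponents that are sums are split, so that an identity with symbolic exponents becomes a
    rational identity between the powers themselves. *)
Ltac pows i l j :=
  rewrite -?(addn1 i) -?(addn1 l) /d_scale /b_scale ?addKn ?half_odd1 ?exprVn ?expr_div_n
    ?(PoszD (i + 1)) ?(PoszD i) ?(PoszD j) ?(PoszD l)
    ?(natrD _ (i + 1)) ?(natrD _ i) ?(natrD _ l)
    ?(mulrDr (2 : int)) ?(mulrDr (4 : int)) ?(expfzDr _ _ two_neq0) ?mulr1
    ?expr1z ?zpowN ?zpowMn ?zpowR ?(exprD _ _ 1) ?(exprD _ (i + l + _))
    ?(exprD _ (i + 1 + l)) ?(exprD _ (i + l)) ?(exprD _ (i + 1)) ?(exprD _ i)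
    ?(exprD _ l) ?expr1 -?exprnP ?(exprD _ j).

Ltac fieldnz := field; rewrite ?expf_neq0 ?factR_neq0 ?two_neq0.

Definition odd_weight k i j : K := (2 * i%:R - 1) ^ (2 * k%:Z - 2 * j%:Z + 4).

Lemma d_weightE k i j :
  d_weight k i j = (-1) ^+ (i + 1) * (2 ^ (2 * k%:Z - 2 * j%:Z + 4) * odd_weight k i j).
Proof. by rewrite /d_weight four_sub2 expfzMl. Qed.

Lemma odd_weightP k i j z : z = 2 * k%:Z - 2 * j%:Z + 4 :> int ->
  (2 * i%:R - 1) ^ z = odd_weight k i j.
Proof. by move=> ->. Qed.

Lemma b_weightP k i j z : z = 2 * k%:Z - 2 * j%:Z + 4 :> int -> i%:R ^ z = b_weight k i j.
Proof. by move=> ->. Qed.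

Definition exp_mul_term (x y : K) j v := x ^+ j / j`!%:R * (y ^+ v / v`!%:R).

(** This lemma and its analogues down to [cK_term] decode the recursion coefficients, with k = i + l
    and q = j + v. A coefficient of the linear part is minus a coefficient of phi times the symbol 2
    - 9 rho + 9 rho^2. A coefficient of the quadratic part is a product of two coefficients of phi,
    the symbol 2 rho (tau - rho), and the factor 2l + 1 or 2l + 2 produced by d/ds. [cD] and [cF]
    are taken at i + 1 because their sums are empty at i = 0. *)
Lemma cA_term k j v : (-1) ^+ k * 2 ^ (- j%:Z + 2 * k%:Z - 2)
    / (j`!%:R * (2 * k)`!%:R * v`!%:R)
  = - (d_scale k * 2 ^ (2 * k%:Z - 1) * (2 - 9 * half_odd 1 + 9 * half_odd 1 ^+ 2)
       * exp_mul_term (half_odd 1) 1 j v).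
Proof. by rewrite /exp_mul_term expr1n; pows j v j; fieldnz. Qed.

Lemma cB_term k j v m r : cB K k (j + v) m r j
  = - (d_scale k * d_weight k m r * (2 - 9 * half_odd r + 9 * half_odd r ^+ 2)
  * exp_mul_term (half_odd r) 1 j v).
Proof.
rewrite /cB d_weightE /exp_mul_term expr1n (@odd_weightP k _ r) //
  -[half_odd r]/((_ - _) / _).
by pows k m j; fieldnz.
Qed.

Lemma cC_term i l j v n t : cC K (i + l) (j + v) n t i j =
  (d_scale i * 2 ^ (2 * i%:Z - 1)) * (b_scale l * b_weight l n t)
  * (2 * half_odd 1 * (t%:R - half_odd 1))
  * exp_mul_term (half_odd 1) t%:R j v * (2 * l%:R + 1).
Proof.
rewrite /cC /exp_mul_term (@b_weightP l n t); last by lia.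
by pows i l j; fieldnz.
Qed.

Lemma cD_term i l j v n t : cD K (i.+1 + l) (j + v) n t i.+1 j =
  (b_scale i * b_weight i n t) * (d_scale l.+1 * 2 ^ (2 * l.+1%:Z - 1))
  * (2 * t%:R * (half_odd 1 - t%:R))
  * exp_mul_term t%:R (half_odd 1) j v * (2 * l.+1%:R).
Proof.
rewrite /cD /exp_mul_term (@b_weightP i n t); last by lia.
rewrite mulnS add2n /= fact2S -(addn1 (2 * i)).
by pows i l j; fieldnz.
Qed.

Lemma cE_term i l j v n t m r : cE K (i + l) (j + v) n t m r i j =
  (d_scale i * d_weight i m r) * (b_scale l * b_weight l n t)
  * (2 * half_odd r * (t%:R - half_odd r))
  * exp_mul_term (half_odd r) t%:R j v * (2 * l%:R + 1).
Proof.
rewrite /cE d_weightE /exp_mul_term (@b_weightP l n t); last by lia.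
rewrite (@odd_weightP i _ r); last by lia.
by rewrite -[half_odd r]/((_ - _) / _); pows i l j; fieldnz.
Qed.

Lemma cF_term i l j v n t m r : cF K (i.+1 + l) (j + v) n t m r i.+1 j =
  (b_scale i * b_weight i n t) * (d_scale l.+1 * d_weight l.+1 m r)
  * (2 * t%:R * (half_odd r - t%:R))
  * exp_mul_term t%:R (half_odd r) j v * (2 * l.+1%:R).
Proof.
rewrite /cF d_weightE /exp_mul_term (@b_weightP i n t); last by lia.
rewrite (@odd_weightP l.+1 _ r); last by lia.
rewrite mulnS add2n /= fact2S -(addn1 (2 * i)).
by rewrite -[half_odd r]/((_ - _) / _); pows i l j; fieldnz.
Qed.

Lemma cG_term k j v m r : cG K k (j + v) m r j =
  - (b_scale k * b_weight k m r * (2 - 9 * r%:R + 9 * r%:R ^+ 2)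
  * exp_mul_term r%:R 1 j v).
Proof.
rewrite /cG /exp_mul_term expr1n (@b_weightP k m r) // exprz16 mulrBr.
by pows k m j; fieldnz.
Qed.

Lemma cH_term i l j v m r : cH K (i + l) (j + v) m r i j =
  (d_scale i * d_weight i m r) * (d_scale l.+1 * 2 ^ (2 * l.+1%:Z - 1))
  * (2 * half_odd r * (half_odd 1 - half_odd r))
  * exp_mul_term (half_odd r) (half_odd 1) j v * (2 * l.+1%:R).
Proof.
rewrite /cH d_weightE /exp_mul_term (@odd_weightP i _ r); last by lia.
rewrite fact2S.
by rewrite -[half_odd r]/((_ - _) / _); pows i l j; fieldnz.
Qed.

Lemma cI_term i l j v n t : cI K (i + l) (j + v) n t i j =
  (d_scale i * 2 ^ (2 * i%:Z - 1)) * (d_scale l.+1 * d_weight l.+1 n t)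
  * (2 * half_odd 1 * (half_odd t - half_odd 1))
  * exp_mul_term (half_odd 1) (half_odd t) j v * (2 * l.+1%:R).
Proof.
rewrite /cI d_weightE /exp_mul_term (@odd_weightP l.+1 _ t); last by lia.
rewrite fact2S.
by rewrite -[half_odd t]/((_ - _) / _); pows i l j; fieldnz.
Qed.

Lemma cJ_term i l j v m r n t : cJ K (i + l) (j + v) m r n t i j =
  (b_scale i * b_weight i m r) * (b_scale l * b_weight l n t) * (2 * r%:R * (t%:R - r%:R))
  * exp_mul_term r%:R t%:R j v * (2 * l%:R + 1).
Proof.
rewrite /cJ /exp_mul_term (@b_weightP i m r); last by lia.
rewrite (@b_weightP l n t); last by lia.
(* [b_scale l] carries (2l+1)! while [cJ] has (2l)!; the factor 2l + 1 from d/ds makes up the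
   difference. *)
have fl : (2 * l + 1)`!%:R = (2 * l%:R + 1) * (2 * l)`!%:R :> K.
  by rewrite addn1 factS natrM -addn1 natrD natrM.
have l0 : 2 * l%:R + 1 != 0 :> K by rewrite -natrM natr1 pnatr_eq0.
by pows i l j; rewrite fl; fieldnz; rewrite l0.
Qed.

Lemma cK_term i l j v m r n t : cK K (i + l) (j + v) m r n t i j =
  (d_scale i * d_weight i m r) * (d_scale l.+1 * d_weight l.+1 n t)
  * (2 * half_odd r * (half_odd t - half_odd r))
  * exp_mul_term (half_odd r) (half_odd t) j v * (2 * l.+1%:R).
Proof.
rewrite /cK !d_weightE /exp_mul_term (@odd_weightP i _ r); last by lia.
rewrite (@odd_weightP l.+1 _ t); last by lia.
rewrite fact2S.
by rewrite
  -[half_odd r]/((_ - _) / _) -[half_odd t]/((_ - _) / _); pows i l j; fieldnz.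
Qed.

End RecursionTerms.

Lemma sum_parity_even (V : nmodType) (F : nat -> V) k :
  \sum_(a < (2 * k).+1) F a
  = \sum_(0 <= i < k.+1) F (2 * i)%N + \sum_(0 <= i < k) F (2 * i + 1)%N.
Proof.
elim: k => [|k IH]; first by rewrite big_ord1 big_nat1 big_geq // addr0.
rewrite (_ : 2 * k.+1 = (2 * k).+2)%N; last by lia.
rewrite 2!big_ord_recr /= IH [X in _ = X + _]big_nat_recr //=.
rewrite [X in _ = _ + X]big_nat_recr //= addn1 mulnS add2n.
by rewrite -!addrA; congr (_ + _); rewrite addrA addrC.
Qed.

Lemma sum_parity_odd (V : nmodType) (F : nat -> V) k :
  \sum_(a < (2 * k + 1).+1) F a
  = \sum_(0 <= i < k.+1) F (2 * i)%N + \sum_(0 <= i < k.+1) F (2 * i + 1)%N.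
Proof.
rewrite addn1 big_ord_recr /= sum_parity_even -addrA; congr (_ + _).
by rewrite [RHS]big_nat_recr //= addn1.
Qed.

(** * The recursions as coefficients of one differential equation *)

Section Recursion.
Context (K : numClosedFieldType).
Implicit Types (rho tau A B : nat -> K).

Definition fexp_sum A rho n : fps K :=
  \sum_(1 <= r < n) fpsC (A r) * fexp (rho r).

Local Notation D := (@fps_deriv K).

Lemma fps_deriv_sum A rho n :
  D (fexp_sum A rho n) = fexp_sum (fun r => A r * rho r) rho n.
Proof.
have dD := @fps_deriv_derivation K.
rewrite /fexp_sum (big_morph D (derivationD dD) (derivation0 dD)).
apply: eq_bigr => r _; rewrite (derivationM dD) fps_deriv_fexp rmorphM mulrA.
rewrite [D _](_ : _ = 0) ?mul0r ?add0r //.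
by apply/fpsP => m; rewrite fps_coef0 /= mul0rn.
Qed.

Lemma fexp_mul_coef (x y : K) q :
  (fexp x * fexp y) q = \sum_(0 <= j < q.+1) exp_mul_term x y j (q - j).
Proof. by rewrite fps_coefM big_mkord. Qed.

Lemma fexp_sum_mul A rho m B tau n q :
  (fexp_sum A rho m * fexp_sum B tau n) q =
  \sum_(0 <= j < q.+1) \sum_(1 <= r < m) \sum_(1 <= t < n)
    A r * B t * exp_mul_term (rho r) (tau t) j (q - j).
Proof.
rewrite /fexp_sum mulr_suml fps_coef_sum [RHS]exchange_big.
apply: eq_bigr => r _; rewrite mulr_sumr fps_coef_sum [RHS]exchange_big.
apply: eq_bigr => t _.
by rewrite -mulr_sumr mulrACA -rmorphM fps_coefCM fexp_mul_coef.
Qed.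

(** The contribution of one pair of s-coefficients to 2 phi_u phi_su - 2 phi_uu phi_s. On e^(rho u)
    and e^(tau u) it multiplies the product by 2 rho tau - 2 rho^2 = 2 rho (tau - rho). *)
Definition bracket (f g : fps K) := 2 * (D f * D g) - D (D f) * (2 * g).

Lemma bracket_coef A rho m B tau n q :
  bracket (fexp_sum A rho m) (fexp_sum B tau n) q =
  \sum_(0 <= j < q.+1) \sum_(1 <= r < m) \sum_(1 <= t < n)
    A r * B t * (2 * rho r * (tau t - rho r))
    * exp_mul_term (rho r) (tau t) j (q - j).
Proof.
rewrite /bracket [X in _ - X]mulrCA -mulrBr -(rmorph_nat (@fpsC K) 2) fps_coefCM.
rewrite fps_coefB !fps_deriv_sum !fexp_sum_mul -sumrB mulr_sumr.
apply: eq_bigr => j _; rewrite -sumrB mulr_sumr; apply: eq_bigr => r _.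
rewrite -sumrB mulr_sumr; apply: eq_bigr => t _.
by move: (exp_mul_term _ _ _ _) => e; ring.
Qed.

Definition lin_op (f : fps K) := fexp 1 * (2 * f - 9 * D f + 9 * D (D f)).

Lemma lin_op_coef A rho n q : lin_op (fexp_sum A rho n) q =
  \sum_(0 <= j < q.+1) \sum_(1 <= r < n)
    A r * (2 - 9 * rho r + 9 * rho r ^+ 2) * exp_mul_term (rho r) 1 j (q - j).
Proof.
have e : fexp 1 = fexp_sum (fun=> 1) (fun=> 1) 2 :> fps K.
  by rewrite /fexp_sum big_nat1 rmorph1 mul1r.
rewrite /lin_op mulrC !fps_deriv_sum e.
rewrite (_ : _ - _ + _ = fexp_sum
  (fun r => A r * (2 - 9 * rho r + 9 * rho r ^+ 2)) rho n).
  rewrite fexp_sum_mul; apply: eq_bigr => j _; apply: eq_bigr => r _.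
  by rewrite big_nat1 mulr1.
rewrite /fexp_sum !mulr_sumr -sumrB -big_split; apply: eq_bigr => r _ /=.
rewrite !rmorphM rmorphD rmorphB !rmorphM !rmorph_nat; ring.
Qed.

Context (b d : nat -> nat -> K) (phi : fps (fps K)).

(* The coefficients of s^(2k+1) e^(j u) and of s^(2k) e^((2j-1) u / 2). *)
Definition odd_coef k j : K := b_scale K k *
  \sum_(1 <= i < j.+1) b_weight K k i j * b i j.
Definition even_coef k j : K := d_scale K k *
  (if j == 1%N then 2 ^ (2 * k%:Z - 1)
   else \sum_(1 <= i < j.+1) d_weight K k i j * d i j).

Hypothesis phi_odd : forall k,
  phi (2 * k + 1)%N = fexp_sum (odd_coef k) (fun j => j%:R) k.+2.
Hypothesis phi_even : forall k,
  phi (2 * k)%N = fexp_sum (even_coef k) (@half_odd K) k.+2.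
Hypothesis phi_eq :
  2 * pd_u phi * pd_u (pd_s phi) - pd_u (pd_u phi) * (2 * pd_s phi)
  = fpsC (fexp 1) * (2 * phi - 9 * pd_u phi + 9 * pd_u (pd_u phi)).

(** Compare coefficients of s^p u^q in [phi_eq]; the multiplicity (p - a) + 1 comes from
    differentiating s^(p-a+1). *)
Lemma phi_eq_coef p q :
  \sum_(a < p.+1) bracket (phi a) (phi (p - a).+1) q *+ (p - a).+1
  = lin_op (phi p) q.
Proof.
have := congr1 (fun X : fps (fps K) => X p q) phi_eq.
rewrite /= fps_coefCM [X in fexp 1 * X](_ : _ = 2 * phi p - 9 * D (phi p)
  + 9 * D (D (phi p))) => [<-|]; last first.
  by rewrite !mulr_natl fps_coefD fps_coefB !fps_coefMn.
rewrite (fps_coefM (2 * pd_u phi)) (fps_coefM (pd_u (pd_u phi))).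
rewrite !fps_coef_sum -sumrB; apply: eq_bigr => a _.
rewrite -fps_coefB -fps_coefMn -fps_coefB; congr fps_coef.
rewrite !mulr_natl !fps_coefMn /pd_u /pd_s /=.
rewrite [D (phi _ *+ _)](_ : _ = D (phi (p - a).+1) *+ (p - a).+1); last first.
  by apply/fpsP => n; rewrite fps_coefMn /= fps_coefMn -!mulrnA mulnC.
by rewrite !mulrnAr !mulrnAl mulrnBl -!mulrnA mulnC.
Qed.

Lemma even_coef1 k : even_coef k 1 = d_scale K k * 2 ^ (2 * k%:Z - 1).
Proof. by []. Qed.

Lemma even_coef_gt1 k j : (1 < j)%N ->
  even_coef k j = d_scale K k * \sum_(1 <= i < j.+1) d_weight K k i j * d i j.
Proof. by case: j => [|[|j]]. Qed.

(** The exponential r = 1 in an even coefficient of phi has the explicit coefficient 2^(2k-1)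
    instead of a sum over d: it yields [cA], and the exponentials r >= 2 yield [cB]. *)
Lemma rec_even_lin k q :
  cA K k q + \sum_(0 <= j < q.+1) \sum_(2 <= r < (k + 1).+1)
    \sum_(1 <= m < r.+1) cB K k q m r j * d m r = - lin_op (phi (2 * k)%N) q.
Proof.
rewrite phi_even lin_op_coef -big_split -sumrN; apply: eq_big_nat => j /= le_jq.
have -> : q = (j + (q - j))%N by lia.
rewrite addKn cA_term [in RHS]big_ltn // even_coef1 opprD addn1; congr (_ + _).
rewrite -sumrN; apply: eq_big_nat => r /andP[r_gt1 _].
rewrite even_coef_gt1 // mulr_sumr !mulr_suml -sumrN.
by apply: eq_bigr => m _; rewrite cB_term; ring.
Qed.

Lemma rec_odd_lin k q :
  \sum_(0 <= j < q.+1) \sum_(1 <= r < (k + 1).+1)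
    \sum_(1 <= m < r.+1) cG K k q m r j * b m r = - lin_op (phi (2 * k + 1)%N) q.
Proof.
rewrite phi_odd lin_op_coef -sumrN; apply: eq_big_nat => j /= le_jq.
have -> : q = (j + (q - j))%N by lia.
rewrite addKn addn1 -sumrN; apply: eq_bigr => r _.
rewrite /odd_coef mulr_sumr !mulr_suml -sumrN.
by apply: eq_bigr => m _; rewrite cG_term; ring.
Qed.

Lemma sum_mul_sum (m n : nat) (f g : nat -> K) (F : nat -> nat -> K) (c : K) :
  (forall i j, F i j = c * (f i * g j)) ->
  \sum_(1 <= i < m) \sum_(1 <= j < n) F i j
  = c * ((\sum_(1 <= i < m) f i) * (\sum_(1 <= j < n) g j)).
Proof.
move=> FE; rewrite mulr_suml mulr_sumr; apply: eq_bigr => i _.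
by rewrite !mulr_sumr; apply: eq_bigr.
Qed.

(** Here and in the next three lemmas a bracket is split by whether an even-index factor contributes
    its explicit exponential r = 1 or one with r >= 2. In this case r = 1 gives [cC], linear in b,
    and r >= 2 gives [cE], bilinear in b and d. *)
Lemma rec_even_odd_part i l q :
  \sum_(0 <= j < q.+1) \sum_(1 <= t < l.+2) \sum_(1 <= n < t.+1)
    cC K (i + l) q n t i j * b n t
  + \sum_(0 <= j < q.+1) \sum_(1 <= t < l.+2) \sum_(1 <= n < t.+1)
    \sum_(2 <= r < i.+2) \sum_(1 <= m < r.+1)
      cE K (i + l) q n t m r i j * b n t * d m r
  = bracket (phi (2 * i)%N) (phi (2 * l + 1)%N) q *+ (2 * l + 1).
Proof.
rewrite phi_even phi_odd bracket_coef -big_split -sumrMnl.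
apply: eq_big_nat => j /= le_jq; have -> : q = (j + (q - j))%N by lia.
rewrite addKn exchange_big -big_split -sumrMnl /=.
apply: eq_bigr => t _; rewrite [in RHS]big_ltn // mulrnDl even_coef1; congr (_ + _).
  rewrite /odd_coef !mulr_sumr !mulr_suml -sumrMnl.
  apply: eq_bigr => n _; rewrite cC_term -[RHS]mulr_natr natrD natrM; ring.
rewrite [LHS]exchange_big -sumrMnl /=.
apply: eq_big_nat => r /andP[r_gt1 _]; rewrite even_coef_gt1 // /odd_coef.
rewrite (@sum_mul_sum _ _ (fun n => b_weight K l n t * b n t)
  (fun m => d_weight K i m r * d m r)
  _ (d_scale K i * b_scale K l * (2 * half_odd K r * (t%:R - half_odd K r))
     * exp_mul_term (half_odd K r) t%:R j (q - j) * (2 * l%:R + 1))).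
  by rewrite -[RHS]mulr_natr natrD natrM; ring.
by move=> n m; rewrite cE_term; ring.
Qed.

Lemma rec_even_even_part i l q :
  \sum_(0 <= j < q.+1) \sum_(1 <= t < i.+2) \sum_(1 <= n < t.+1)
    cD K (i.+1 + l) q n t i.+1 j * b n t
  + \sum_(0 <= j < q.+1) \sum_(1 <= t < i.+2) \sum_(1 <= n < t.+1)
    \sum_(2 <= r < l.+3) \sum_(1 <= m < r.+1)
      cF K (i.+1 + l) q n t m r i.+1 j * b n t * d m r
  = bracket (phi (2 * i + 1)%N) (phi (2 * l.+1)%N) q *+ (2 * l.+1).
Proof.
rewrite phi_even phi_odd bracket_coef -big_split -sumrMnl.
apply: eq_big_nat => j /= le_jq; have -> : q = (j + (q - j))%N by lia.
rewrite addKn -big_split -sumrMnl /=.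
apply: eq_bigr => t _; rewrite [in RHS]big_ltn // mulrnDl even_coef1; congr (_ + _).
  rewrite /odd_coef !mulr_sumr !mulr_suml -sumrMnl.
  by apply: eq_bigr => n _; rewrite cD_term -[RHS]mulr_natr natrM; ring.
rewrite [LHS]exchange_big -sumrMnl /=.
apply: eq_big_nat => r /andP[r_gt1 _]; rewrite even_coef_gt1 // /odd_coef.
rewrite (@sum_mul_sum _ _ (fun n => b_weight K i n t * b n t)
  (fun m => d_weight K l.+1 m r * d m r)
  _ (b_scale K i * d_scale K l.+1 * (2 * t%:R * (half_odd K r - t%:R))
     * exp_mul_term t%:R (half_odd K r) j (q - j) * (2 * l.+1%:R))).
  by rewrite -[RHS]mulr_natr natrM; ring.
by move=> n m; rewrite cF_term; ring.
Qed.

Lemma rec_odd_odd_part i l q :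
  \sum_(0 <= j < q.+1) \sum_(1 <= r < i.+2) \sum_(1 <= t < l.+2)
    \sum_(1 <= m < r.+1) \sum_(1 <= n < t.+1)
      cJ K (i + l) q m r n t i j * b m r * b n t
  = bracket (phi (2 * i + 1)%N) (phi (2 * l + 1)%N) q *+ (2 * l + 1).
Proof.
rewrite !phi_odd bracket_coef -sumrMnl.
apply: eq_big_nat => j /= le_jq; have -> : q = (j + (q - j))%N by lia.
rewrite addKn -sumrMnl; apply: eq_bigr => r _; rewrite -sumrMnl.
apply: eq_bigr => t _; rewrite /odd_coef.
rewrite (@sum_mul_sum _ _ (fun m => b_weight K i m r * b m r)
  (fun n => b_weight K l n t * b n t)
  _ (b_scale K i * b_scale K l * (2 * r%:R * (t%:R - r%:R))
     * exp_mul_term r%:R t%:R j (q - j) * (2 * l%:R + 1))).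
  by rewrite -[RHS]mulr_natr natrD natrM; ring.
by move=> m n; rewrite cJ_term; ring.
Qed.

Lemma rec_odd_even_part i l q :
  \sum_(0 <= j < q.+1) \sum_(2 <= r < i.+2) \sum_(1 <= m < r.+1)
    cH K (i + l) q m r i j * d m r
  + \sum_(0 <= j < q.+1) \sum_(2 <= t < l.+3) \sum_(1 <= n < t.+1)
    cI K (i + l) q n t i j * d n t
  + \sum_(0 <= j < q.+1) \sum_(2 <= r < i.+2) \sum_(2 <= t < l.+3)
    \sum_(1 <= m < r.+1) \sum_(1 <= n < t.+1)
      cK K (i + l) q m r n t i j * d m r * d n t
  = bracket (phi (2 * i)%N) (phi (2 * l.+1)%N) q *+ (2 * l.+1).
Proof.
rewrite !phi_even bracket_coef -!big_split -sumrMnl.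
apply: eq_big_nat => j /= le_jq; have -> : q = (j + (q - j))%N by lia.
(* The pair of two explicit exponentials drops out, since the symbol 2 rho (tau - rho) is 0 at rho =
   tau; hence no constant term in the odd recursion. *)
rewrite addKn [in RHS]big_ltn // [X in (X + _) *+ _]big_ltn // subrr mulr0 mulr0.
rewrite mul0r add0r mulrnDl [X in X + _ = _]addrC -addrA; congr (_ + _).
  rewrite -sumrMnl; apply: eq_big_nat => t /andP[t_gt1 _].
  rewrite even_coef1 even_coef_gt1 // !mulr_sumr !mulr_suml -sumrMnl.
  by apply: eq_bigr => n _; rewrite cI_term -[RHS]mulr_natr natrM; ring.
rewrite -big_split -sumrMnl; apply: eq_big_nat => r /andP[r_gt1 _] /=.
rewrite [in RHS]big_ltn // mulrnDl even_coef1 even_coef_gt1 //; congr (_ + _).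
  rewrite !mulr_sumr !mulr_suml -sumrMnl.
  by apply: eq_bigr => m _; rewrite cH_term -[RHS]mulr_natr natrM; ring.
rewrite -sumrMnl; apply: eq_big_nat => t /andP[t_gt1 _]; rewrite even_coef_gt1 //.
rewrite (@sum_mul_sum _ _ (fun m => d_weight K i m r * d m r)
  (fun n => d_weight K l.+1 n t * d n t)
  _ (d_scale K i * d_scale K l.+1
  * (2 * half_odd K r * (half_odd K t - half_odd K r))
     * exp_mul_term (half_odd K r) (half_odd K t) j (q - j) * (2 * l.+1%:R))).
  by rewrite -[RHS]mulr_natr natrM; ring.
by move=> m n; rewrite cK_term; ring.
Qed.

Lemma rec_even_sol k q : rec_even b d k q.
Proof.
rewrite /rec_even rec_even_lin -phi_eq_coef.
rewrite (sum_parity_even (fun a => bracket (phi a) (phi (2 * k - a).+1) q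
  *+ (2 * k - a).+1)).
set X3 := \sum_(0 <= i < k.+1) _; set X4 := \sum_(0 <= i < k.+1) _.
set X5 := \sum_(0 <= i < k.+1) _; set X6 := \sum_(0 <= i < k.+1) _.
set Y1 := \sum_(0 <= i < k.+1) _; set Y2 := \sum_(0 <= i < k) _.
have E1 : X3 + X5 = Y1.
  rewrite -big_split; apply: eq_big_nat => i /= le_ik.
  rewrite (_ : (2 * k - 2 * i).+1 = 2 * (k - i) + 1)%N; last by lia.
  have -> : k = (i + (k - i))%N by lia.
  by rewrite addKn !(addn1 (k - i)) !(addn1 i) rec_even_odd_part.
(* At i = 0 the range 1 <= t <= i is empty, so these sums begin at i = 1 and match the odd indices
   2i + 1 after a shift. *)
have E2 : X4 + X6 = Y2.
  rewrite -big_split big_nat_recl //= [X in X + _](_ : _ = 0) ?add0r.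
    apply: eq_big_nat => i /= lt_ik.
    rewrite (_ : (2 * k - (2 * i + 1)).+1 = 2 * (k - i.+1).+1)%N; last by lia.
    have -> : k = (i.+1 + (k - i.+1))%N by lia.
    by rewrite addKn !(addn2 (k - i.+1)) rec_even_even_part.
  by rewrite !big1 ?addr0 // => j _; rewrite big_geq.
by rewrite -E1 -E2; ring.
Qed.

Lemma rec_odd_sol k q : rec_odd b d k q.
Proof.
rewrite /rec_odd rec_odd_lin -phi_eq_coef.
rewrite (sum_parity_odd (fun a => bracket (phi a) (phi (2 * k + 1 - a).+1) q
  *+ (2 * k + 1 - a).+1)).
set X3 := \sum_(0 <= i < k.+1) _; set X4 := \sum_(0 <= i < k.+1) _.
set X5 := \sum_(0 <= i < k.+1) _; set X6 := \sum_(0 <= i < k.+1) _.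
set Y1 := \sum_(0 <= i < k.+1) _; set Y2 := \sum_(0 <= i < k.+1) _.
have E1 : X3 + X4 + X6 = Y1.
  rewrite -!big_split; apply: eq_big_nat => i /= le_ik.
  rewrite (_ : (2 * k + 1 - 2 * i).+1 = 2 * (k - i).+1)%N; last by lia.
  have -> : k = (i + (k - i))%N by lia.
  by rewrite addKn !(addn1 i) !(addn2 (k - i)) rec_odd_even_part.
have E2 : X5 = Y2.
  apply: eq_big_nat => i /= le_ik.
  rewrite (_ : (2 * k + 1 - (2 * i + 1)).+1 = 2 * (k - i) + 1)%N; last by lia.
  have -> : k = (i + (k - i))%N by lia.
  by rewrite addKn !(addn1 (k - i)) !(addn1 i) rec_odd_odd_part.
by rewrite -E1 -E2; ring.
Qed.

End Recursion.

(** * The numbers b and d *)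

Section Expansion.
Context (K : numClosedFieldType) (q r : fps K).
Hypotheses (q0 : q 0%N = 1) (qr : q * r = 1) (q3 : q ^+ 3 = q - fpsX K).

Local Notation phi := (open_sol q r).

(** Only the n with p + n even contribute to s^p, because C S^n has the parity of n in s. Its
    multiple-angle coefficients [beta] and [delta], times the Taylor coefficients [e] of (r + 3
    q)/4, are b and d up to the powers of i prescribed by [a_coef]. *)
Lemma open_sol_expansion : exists b d : nat -> nat -> K,
  [/\ b 1%N 1%N = - 8, d 1%N 1%N = 1,
      forall k, phi (2 * k + 1)%N = fexp_sum (odd_coef b k) (fun j => j%:R) k.+2 &
      forall k, phi (2 * k)%N = fexp_sum (even_coef d k) (@half_odd K) k.+2].
Proof.
pose e n : K := (1 / 4) * (r + q *+ 3) n.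
have r0 : r 0%N = 1.
  by have := congr1 (fun X : fps K => X 0%N) qr; rewrite fps_coefM0 q0 mul1r.
have coef1M (X Y : fps K) : (X * Y) 1%N = X 0%N * Y 1%N + X 1%N * Y 0%N.
  by rewrite fps_coefM !big_ord_recl big_ord0 addr0.
(* The linear coefficient of the cubic reads 3 q_1 = q_1 - 1. *)
have q1 : q 1%N = - (1 / 2).
  have := congr1 (fun X : fps K => X 1%N) q3.
  rewrite !exprS expr0 mulr1 !coef1M fps_coefM0 q0 fps_coefB /= => /eqP.
  rewrite -subr_eq0 => /eqP h.
  by rewrite -[LHS]subr0 -(mul0r (1 / 2)) -[X in _ - X * _]h; field.
have r1 : r 1%N = 1 / 2.
  have := congr1 (fun X : fps K => X 1%N) qr; rewrite coef1M q0 r0 q1 /= => /eqP.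
  by rewrite -subr_eq0 => /eqP h; rewrite -[LHS]subr0 -[X in _ - X]h; field.
have e0 : e 0%N = 1 by rewrite /e fps_coefD fps_coefMn q0 r0; field.
have e1 : e 1%N = - (1 / 4) by rewrite /e fps_coefD fps_coefMn q1 r1; field.
have [beta betaE] := choice (@fcos_mul_fsin_odd K).
have [delta deltaE] := choice (@fcos_mul_fsin_even K).
(* Its value is read off the coefficient of s in cos 2s sin 2s = beta sin 4s, that is, 2 = 4
   beta. *)
have beta01 : beta 0%N 1%N = 1 / 2.
  have := congr1 (fun X : fps K => X 1%N) (betaE 0%N).
  rewrite big_nat1 fps_coefCM expr1 coef1M.
  rewrite -[0%N]/(2 * 0)%N fsin_coef_even mulr0 addr0.
  rewrite fcos_coef_even -[1%N]/(2 * 0 + 1)%N !fsin_coef_odd /= => h.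
  apply: (@mulIf _ 4); rewrite ?pnatr_eq0 //; move: h.
  by rewrite !expr0 !expr1 !divr1 !mul1r mulr1 => <-; field.
(* The factor i^(2j-3) completes the weight i^(2k-2j+4) to i^(2k+1), as in the Taylor coefficient of
   sin 4is; 64 balances 2^(4k-4) against 4^(2k+1). *)
pose b i j := 64 * e (2 * j).-1 * beta j.-1 i * i%:R ^ (2 * j%:Z - 3).
(* For j = 1 the term of the expansion is cos 2s e^(u/2), the summand 2^(p-1) of [a_coef], so d
   takes its normalised value 1. For j >= 2 the power completes the weight to (4i-2)^(2k), the signs
   square away, and 1/2 offsets the 2 in [d_scale]. *)
pose d i j := if j == 1%N then 1 else
  (1 / 2) * (-1) ^+ (i + 1) * (4 * i%:R - 2) ^ (2 * j%:Z - 4)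
  * e (2 * j.-1)%N * delta j.-1 i.
exists b, d; split=> [||k|k] //.
- by rewrite /b /= e1 beta01 exp1rz; field.
- rewrite open_sol_coef (sum_parity_odd (fun n =>
    fpsC (1 / 4 * (r + q *+ 3) n * (fcos 2 * fsin 2 ^+ n) (2 * k + 1)%N)
    * fexp (n.+1%:R / 2))).
  rewrite [X in X + _]big1 ?add0r => [|i _]; last first.
    rewrite deltaE fps_coef_sum big1 ?mulr0 ?rmorph0 ?mul0r // => n _.
    by rewrite fps_coefCM fcos_coef_odd mulr0.
  rewrite /fexp_sum [RHS]big_add1 /=; apply: eq_bigr => i _.
  congr (fpsC _ * fexp _); last by rewrite -addnS -mulnSr natrM; field.
  rewrite -/(e _) addn1 betaE fps_coef_sum /odd_coef !mulr_sumr.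
  apply: eq_big_nat => n /andP[n_gt0 _].
  have n0 : n%:R != 0 :> K by rewrite pnatr_eq0 -lt0n.
  rewrite fps_coefCM fsin_coef_odd /b (_ : (2 * i.+1).-1 = (2 * i).+1); last by lia.
  rewrite exprMn /=.
  rewrite [RHS](_ : _ = b_scale K k * (b_weight K k n i.+1 * n%:R ^ (2 * i.+1%:Z - 3))
    * 64 * e (2 * i).+1 * beta i n); last by ring.
  rewrite /b_weight -expfzDr // [X in _ ^ X](_ : _ = (2 * k + 1)%:Z); last by lia.
  rewrite -exprnP /b_scale.
  rewrite (_ : 2 ^ _ = 4 ^+ (2 * k + 1) / 64).
    by field; exact: factR_neq0.
  rewrite (expfzDr _ _ (two_neq0 K)) zpowN zpowMn zpowR exprD exprM expr1.
  rewrite (_ : 2 ^+ k ^+ 4 = 4 ^+ 2 ^+ k); first by field.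
  by rewrite -exprM mulnC exprM; congr (_ ^+ _); ring.
- rewrite open_sol_coef (sum_parity_even (fun n =>
    fpsC (1 / 4 * (r + q *+ 3) n * (fcos 2 * fsin 2 ^+ n) (2 * k)%N)
    * fexp (n.+1%:R / 2))).
  (* For odd n, C S^n is a combination of sines and has no even coefficients in s. *)
  rewrite [X in _ + X]big1 ?addr0 => [|i _]; last first.
    rewrite addn1 betaE fps_coef_sum big1 ?mulr0 ?rmorph0 ?mul0r // => n _.
    by rewrite fps_coefCM fsin_coef_even mulr0.
  rewrite /fexp_sum [RHS]big_add1 /=; apply: eq_bigr => i _.
  congr (fpsC _ * fexp _); last first.
    by rewrite /half_odd -natr1 natrM -natr1; field.
  rewrite -/(e _); case: i => [|i].
    rewrite muln0 expr0 mulr1 e0 mul1r even_coef1 fcos_coef_even /d_scale.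
    rewrite (expfzDr _ _ (two_neq0 K)) zpowN zpowMn expr1z -exprM (mulnC k).
    by field; exact: factR_neq0.
  rewrite deltaE fps_coef_sum even_coef_gt1 // !mulr_sumr.
  apply: eq_big_nat => n /andP[n_gt0 _].
  have n0 : 4 * n%:R - 2 != 0 :> K.
    by rewrite -natrM -natrB ?pnatr_eq0; lia.
  rewrite fps_coefCM fcos_coef_even /d /=.
  rewrite [RHS](_ : _ = d_scale K k * (((-1) ^+ (n + 1)) ^+ 2 *
    ((4 * n%:R - 2) ^ (2 * k%:Z - 2 * i.+2%:Z + 4)
     * (4 * n%:R - 2) ^ (2 * i.+2%:Z - 4)))
    * (1 / 2) * e (2 * i.+1)%N * delta i.+1 n); last by rewrite /d_weight; ring.
  rewrite -expfzDr // [X in _ ^ X](_ : _ = (2 * k)%:Z); last by lia.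
  rewrite -exprnP sqrr_sign /d_scale.
  by field; exact: factR_neq0.
Qed.

End Expansion.

(** The coefficient of u^q in e^(rho u) is rho^q / q!; in the even case the separate summand 2^(p-1)
    is the exponential j = 1. *)
Lemma a_coefE (K : numClosedFieldType) (b d : nat -> nat -> K) (phi : fps (fps K)) :
  (forall k, phi (2 * k + 1)%N = fexp_sum (odd_coef b k) (fun j => j%:R) k.+2) ->
  (forall k, phi (2 * k)%N = fexp_sum (even_coef d k) (@half_odd K) k.+2) ->
  forall p q, a_coef b d p q = phi p q.
Proof.
move=> phi_odd phi_even p q; rewrite /a_coef; case: ifPn => podd.
  have [k ->] : exists k, p = (2 * k + 1)%N by exists p./2; lia.
  rewrite phi_odd /fexp_sum fps_coef_sum.
  have -> : ((2 * k + 1 - 1) %/ 2 = k)%N by lia.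
  have -> : ((2 * k + 1 + 1) %/ 2 = k.+1)%N by lia.
  rewrite mulr_sumr; apply: eq_bigr => j _; rewrite fps_coefCM /= /odd_coef /b_scale.
  rewrite (_ : 2 * (2 * k + 1)%:Z - 6 = 4 * k%:Z - 4); last by lia.
  rewrite [X in _ / _ * (_ * X)](_ : _ =
  \sum_(1 <= i < j.+1) b_weight K k i j * b i j).
    by field; rewrite !factR_neq0.
  by apply: eq_bigr => i _; congr (_ ^ _ * _); lia.
have [k ->] : exists k, p = (2 * k)%N by exists p./2; lia.
rewrite phi_even /fexp_sum fps_coef_sum mulKn //.
rewrite [RHS]big_ltn // fps_coefCM even_coef1 mulrDr addrC; congr (_ + _).
  rewrite /d_scale half_odd1 !(expfzDr _ _ (two_neq0 K)) zpowN expr1z.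
  rewrite -!exprnP /= exprVn.
  by field; rewrite !factR_neq0 expf_neq0 // two_neq0.
rewrite addn1 mulr_sumr; apply: eq_big_nat => j /andP[j_gt1 _].
rewrite fps_coefCM even_coef_gt1 //= /d_scale /half_odd expr_div_n.
rewrite [X in _ / _ * (_ * X)](_ : _ =
  \sum_(1 <= i < j.+1) d_weight K k i j * d i j).
  rewrite (expfzDr _ _ (two_neq0 K)) zpowN expr1z -exprnP.
  by field; rewrite !factR_neq0 expf_neq0 // two_neq0.
by apply: eq_bigr => i _; congr (_ * _ ^ _ * _); lia.
Qed.

(** * Derivations of the ring of series *)

Section MonoidAlgebraDerivation.
Context (K : comNzRingType) (M : nmodType).
Implicit Types (g : monoid_algebra K M) (h : M -> monoid_algebra K M).

Lemma ma_monM (a b : K) (k l : M) :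
  ma_mon a k * ma_mon b l = ma_mon (a * b) (k + l).
Proof. exact: ma_mulUU. Qed.

Lemma ma_monM1 (a : K) (k l : M) : ma_mon a k * ma_mon 1 l = ma_mon a (k + l).
Proof. by rewrite ma_monM mulr1. Qed.

Lemma ma_mon1M (a : K) (k l : M) : ma_mon 1 k * ma_mon a l = ma_mon a (k + l).
Proof. by rewrite ma_monM mul1r. Qed.

Definition ma_const (c : K) : monoid_algebra K M := ma_mon c 0.

Fact ma_const_zmod_morphism : zmod_morphism ma_const.
Proof. by move=> a b; rewrite /ma_const /ma_mon monalgUB. Qed.

Fact ma_const_monoid_morphism : monoid_morphism ma_const.
Proof. by split=> // a b; rewrite /ma_const ma_monM addr0. Qed.

HB.instance Definition _ := GRing.isZmodMorphism.Build
  K (monoid_algebra K M) ma_const ma_const_zmod_morphism.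
HB.instance Definition _ := GRing.isMonoidMorphism.Build
  K (monoid_algebra K M) ma_const ma_const_monoid_morphism.

Lemma ma_scaleE (c : K) g : c *: g = ma_const c * g.
Proof.
rewrite [g in RHS]monalgE mulr_sumr [g in LHS]monalgE scaler_sumr.
apply: eq_bigr => k _.
rewrite -[<< _ *g _ >>]/(ma_mon _ _) ma_monM add0r.
by apply/malgP => l; rewrite mcoeffZ !mcoeffU mulrnAr.
Qed.

Lemma ma_linw h g (d : {fset M}) : (msupp g `<=` d)%fset ->
  ma_lin h g = \sum_(k <- d) g@_k *: h k.
Proof.
move=> le_gd; rewrite /ma_lin (big_fset_incl _ le_gd) // => k _ /mcoeff_outdom ->.
by rewrite scale0r.
Qed.

Lemma ma_linD h g1 g2 : ma_lin h (g1 + g2) = ma_lin h g1 + ma_lin h g2.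
Proof.
rewrite (ma_linw _ (msuppD_le g1 g2)) (ma_linw _ (fsubsetUl _ (msupp g2))).
rewrite (ma_linw _ (fsubsetUr (msupp g1) _)) -big_split /=.
by apply: eq_bigr => k _; rewrite mcoeffD scalerDl.
Qed.

Lemma ma_lin0 h : ma_lin h 0 = 0.
Proof. by apply: (addrI (ma_lin h 0)); rewrite -ma_linD !addr0. Qed.

Lemma ma_lin_mon h c k : ma_lin h (ma_mon c k) = ma_const c * h k.
Proof. by rewrite (ma_linw _ msuppU_le) big_seq_fset1 mcoeffUU ma_scaleE. Qed.

Lemma ma_lin_derivation h :
  (forall k l, h (k + l) = h k * ma_mon 1 l + ma_mon 1 k * h l) ->
  derivation (ma_lin h).
Proof.
move=> hD; split=> [|g1 g2]; first exact: ma_linD.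
have sumE I (r : seq I) F :
    ma_lin h (\sum_(i <- r) F i) = \sum_(i <- r) ma_lin h (F i).
  exact: (big_morph _ (ma_linD h) (ma_lin0 h)).
have monE g : g = \sum_(k <- msupp g) ma_mon g@_k k by apply: monalgE.
rewrite (monE g1) (monE g2) [in RHS]sumE !mulr_suml sumE -big_split.
apply: eq_bigr => k _ /=.
rewrite [in RHS]sumE !mulr_sumr sumE -big_split; apply: eq_bigr => l _ /=.
rewrite ma_monM !ma_lin_mon hD rmorphM.
have e c k' : ma_mon c k' = ma_const c * ma_mon 1 k' by rewrite ma_monM mulr1 add0r.
by rewrite (e g1@_k k) (e g2@_l l); ring.
Qed.

End MonoidAlgebraDerivation.

Lemma ma_monDl (K : comNzRingType) (M : nmodType) (x y : K) (k : M) :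
  ma_mon (x + y) k = ma_mon x k + ma_mon y k.
Proof. exact: monalgUD. Qed.

Lemma ma_mon0 (K : comNzRingType) (M : nmodType) (k : M) :
  ma_mon 0 k = 0 :> monoid_algebra K M.
Proof. exact: monalgU0. Qed.

Lemma derivation_add (A : comNzRingType) (D1 D2 : A -> A) :
  derivation D1 -> derivation D2 -> derivation (fun X => D1 X + D2 X).
Proof.
by move=> [D1D D1M] [D2D D2M]; split=> X Y; rewrite ?D1D ?D2D ?D1M ?D2M; ring.
Qed.

Lemma derivation_sub_mul (A : comNzRingType) (c : A) (D1 D2 : A -> A) :
  derivation D1 -> derivation D2 -> derivation (fun X => D1 X - c * D2 X).
Proof.
by move=> [D1D D1M] [D2D D2M]; split=> X Y; rewrite ?D1D ?D2D ?D1M ?D2M; ring.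
Qed.

Section Embedding.
Context (K : numClosedFieldType).

Lemma coef_d1_derivation : derivation (@coef_d1 K).
Proof.
apply: ma_lin_derivation => -[[a b] c] [[a' b'] c'] /=.
rewrite ma_monM1 ma_mon1M natrD ma_monDl.
(* At exponent 0 the truncated predecessor is harmless, since the monomial comes with coefficient 0;
   likewise for a'. *)
case: a => [|a]; first by rewrite !ma_mon0 !add0r.
case: a' => [|a']; first by rewrite !ma_mon0 !addr0.
apply: (f_equal2 +%R); first exact: erefl.
apply: (congr1 (ma_mon _)).
exact: (congr1 (fun n => (n, b + b', c + c') : exponent) (addnS a a')).
Qed.

Lemma coef_d2_derivation : derivation (@coef_d2 K).
Proof.
apply: ma_lin_derivation => -[[a b] c] [[a' b'] c'].
pose k : exponent := (a + a', b + b' - 1, c + c').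
have e1 : ma_mon b%:~R ((a, b - 1, c) : exponent)
    * ma_mon 1 ((a', b', c') : exponent) = ma_mon b%:~R k :> coef K.
  apply: (etrans (ma_monM1 _ _ _)); apply: (congr1 (ma_mon _)).
  exact: (congr1 (fun n => (a + a', n, c + c') : exponent) (addrAC b (- 1) b')).
have e2 : ma_mon 1 ((a, b, c) : exponent)
    * ma_mon b'%:~R ((a', b' - 1, c') : exponent) = ma_mon b'%:~R k :> coef K.
  apply: (etrans (ma_mon1M _ _ _)); apply: (congr1 (ma_mon _)).
  exact: (congr1 (fun n => (a + a', n, c + c') : exponent) (addrA b b' (- 1))).
apply: (etrans _ (esym (f_equal2 +%R e1 e2))); apply: (etrans _ (ma_monDl _ _ _)).
exact: (congr1 (fun x => ma_mon x k) (intrD K b b')).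
Qed.

Lemma coef_d3_derivation : derivation (@coef_d3 K).
Proof.
apply: ma_lin_derivation => -[[a b] c] [[a' b'] c'] /=.
rewrite ma_monM1 ma_mon1M natrD ma_monDl.
case: c => [|c]; first by rewrite !ma_mon0 !add0r.
case: c' => [|c']; first by rewrite !ma_mon0 !addr0.
apply: (f_equal2 +%R); first exact: erefl.
apply: (congr1 (ma_mon _)).
exact: (congr1 (fun n => (a + a', b + b', n) : exponent) (addnS c c')).
Qed.

Lemma coefwise_derivation (f : coef K -> coef K) :
  derivation f -> derivation (coefwise f).
Proof. by move=> df; do 2!apply: fps_map_derivation. Qed.

Lemma du_derivation : derivation (@du K).
Proof. exact: fps_map_derivation (@fps_deriv_derivation _). Qed.

Lemma ds_derivation : derivation (@ds K).
Proof. exact: fps_deriv_derivation. Qed.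

Lemma d1_derivation : derivation (@d1 K).
Proof. exact: coefwise_derivation coef_d1_derivation. Qed.

Lemma d2_derivation : derivation (@d2 K).
Proof.
exact: derivation_sub_mul (coefwise_derivation coef_d2_derivation) du_derivation.
Qed.

Lemma d3_derivation : derivation (@d3 K).
Proof.
exact: derivation_add (coefwise_derivation coef_d3_derivation) du_derivation.
Qed.

(** A function of s and u alone, such as phi, has coefficients constant in t^1, t^2, t^3. On the
    image the derivatives in t^2 and t^3 reduce to the chain rule through u. *)
Definition embed : fps (fps K) -> series K :=
  fps_lift (fps_lift (@ma_const K exponent)).

HB.instance Definition _ := GRing.RMorphism.on embed.

Lemma ds_embed X : ds (embed X) = embed (pd_s X).
Proof. exact: fps_deriv_lift. Qed.

Lemma du_embed X : du (embed X) = embed (pd_u X).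
Proof. by apply/fpsP => p; rewrite /= fps_deriv_lift. Qed.

Lemma coefwise_embed h X : h 0 = 0 -> coefwise (ma_lin h) (embed X) = 0.
Proof.
move=> h0; apply/fpsP => p; apply/fpsP => q; rewrite !fps_coef0 /=.
by rewrite ma_lin_mon h0 mulr0.
Qed.

Lemma d1_embed X : d1 (embed X) = 0.
Proof. exact/coefwise_embed/ma_mon0. Qed.

Lemma d2_embed X : d2 (embed X) = - 3 * t2V K * embed (pd_u X).
Proof.
have e0 : coefwise (@coef_d2 K) (embed X) = 0 by exact/coefwise_embed/ma_mon0.
by rewrite /d2 e0 du_embed sub0r !mulNr.
Qed.

Lemma d3_embed X : d3 (embed X) = embed (pd_u X).
Proof.
have e0 : coefwise (@coef_d3 K) (embed X) = 0 by exact/coefwise_embed/ma_mon0.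
by rewrite /d3 e0 du_embed add0r.
Qed.

Lemma cstE (c : K) : cst c = embed (fpsC (fpsC c)).
Proof. by rewrite /embed fps_lift_fpsC /= fps_lift_fpsC. Qed.

Lemma coefwise_mon h a b c : coefwise (ma_lin h) (mon K a b c)
  = fpsC (fpsC (h (a, b, c))).
Proof.
have l0 : ma_lin h 0 = 0 by apply: ma_lin0.
apply/fpsP => -[|p]; apply/fpsP => -[|q] //=.
by rewrite ma_lin_mon rmorph1 mul1r.
Qed.

Lemma du_mon a b c : du (mon K a b c) = 0.
Proof.
apply/fpsP => -[|p]; first exact: fps_deriv_fpsC.
exact: (derivation0 (@fps_deriv_derivation _)).
Qed.

Lemma ds_mon a b c : ds (mon K a b c) = 0.
Proof. exact: fps_deriv_fpsC. Qed.

Lemma exp_uE : exp_u K = embed (fpsC (fexp 1)).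
Proof.
rewrite /embed fps_lift_fpsC; apply: (congr1 (@fpsC _)).
apply/fpsP => n /=.
by rewrite expr1n mul1r.
Qed.

Local Notation t1 := (t1 K).
Local Notation t2 := (t2 K).
Local Notation t2V := (t2V K).
Local Notation t3 := (t3 K).
Local Notation s := (s K).

Lemma d2_mon a b c : d2 (mon K a b c) = cst b%:~R * mon K a (b - 1) c.
Proof.
rewrite /d2 du_mon mulr0 subr0; apply: etrans (coefwise_mon _ _ _ _) _.
by rewrite /mon /cst -!rmorphM ma_monM mulr1 add0r.
Qed.

Lemma d3_mon a b c : d3 (mon K a b c) = cst c%:R * mon K a b c.-1.
Proof.
rewrite /d3 du_mon addr0; apply: etrans (coefwise_mon _ _ _ _) _.
by rewrite /mon /cst -!rmorphM ma_monM mulr1 add0r.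
Qed.

Lemma d1_mon a b c : d1 (mon K a b c) = cst a%:R * mon K a.-1 b c.
Proof.
apply: etrans (coefwise_mon _ _ _ _) _.
by rewrite /mon /cst -!rmorphM ma_monM mulr1 add0r.
Qed.

Lemma cst0 : cst 0 = 0 :> series K. Proof. by rewrite cstE !rmorph0. Qed.
Lemma cst1 : cst 1 = 1 :> series K. Proof. by rewrite cstE !rmorph1. Qed.
Lemma cstM (x y : K) : cst (x * y) = cst x * cst y.
Proof. by rewrite !cstE !rmorphM. Qed.
Lemma cst_nat n : cst n%:R = n%:R :> series K.
Proof. by rewrite !cstE !rmorph_nat. Qed.

Lemma monM a b c a' b' c' :
  mon K a b c * mon K a' b' c' = mon K (a + a') (b + b') (c + c').
Proof. by rewrite /mon -!rmorphM ma_monM1. Qed.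

Lemma mon000 : mon K 0 0 0 = 1. Proof. exact: cst1. Qed.

Lemma t2K : t2 * t2V = 1.
Proof. by rewrite /Defs.t2 /Defs.t2V monM subrr; exact: mon000. Qed.

Lemma d1_t1 : d1 t1 = 1.
Proof. by rewrite /Defs.t1 d1_mon cst1 mul1r mon000. Qed.
Lemma d1_t2 : d1 t2 = 0.
Proof. by rewrite /Defs.t2 d1_mon cst0 mul0r. Qed.
Lemma d1_t3 : d1 t3 = 0.
Proof. by rewrite /Defs.t3 d1_mon cst0 mul0r. Qed.
Lemma d2_t1 : d2 t1 = 0.
Proof. by rewrite /Defs.t1 d2_mon cst0 mul0r. Qed.
Lemma d2_t2 : d2 t2 = 1.
Proof. by rewrite /Defs.t2 d2_mon cst1 mul1r mon000. Qed.
Lemma d2_t3 : d2 t3 = 0.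
Proof. by rewrite /Defs.t3 d2_mon cst0 mul0r. Qed.
Lemma d3_t1 : d3 t1 = 0.
Proof. by rewrite /Defs.t1 d3_mon cst0 mul0r. Qed.
Lemma d3_t2 : d3 t2 = 0.
Proof. by rewrite /Defs.t2 d3_mon cst0 mul0r. Qed.
Lemma d3_t3 : d3 t3 = 1.
Proof. by rewrite /Defs.t3 d3_mon cst1 mul1r mon000. Qed.
Lemma pd_u_const (x : K) : pd_u (fpsC (fpsC x)) = 0.
Proof.
apply/fpsP => -[|p]; first exact: fps_deriv_fpsC.
exact: (derivation0 (@fps_deriv_derivation _)).
Qed.

Lemma d1_cst x : d1 (cst x) = 0 :> series K. Proof. by rewrite cstE d1_embed. Qed.
Lemma d2_cst x : d2 (cst x) = 0 :> series K.
Proof. by rewrite cstE d2_embed pd_u_const rmorph0 mulr0. Qed.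
Lemma d3_cst x : d3 (cst x) = 0 :> series K.
Proof. by rewrite cstE d3_embed pd_u_const rmorph0. Qed.

Lemma coefwise_s D : derivation D -> coefwise D s = 0.
Proof.
move=> dD; apply/fpsP => p; rewrite fps_coef0.
exact: (derivation_nat (fps_map_derivation dD)).
Qed.

Lemma du_s : du s = 0.
Proof.
apply/fpsP => p; rewrite fps_coef0.
exact: (derivation_nat (@fps_deriv_derivation _)).
Qed.

Lemma d1_s : d1 s = 0. Proof. exact: coefwise_s coef_d1_derivation. Qed.
Lemma d2_s : d2 s = 0.
Proof. by rewrite /d2 du_s (coefwise_s coef_d2_derivation) mulr0 subr0. Qed.
Lemma d3_s : d3 s = 0.
Proof. by rewrite /d3 du_s (coefwise_s coef_d3_derivation) addr0. Qed.

Lemma ds_s : ds s = 1.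
Proof.
apply/fpsP => -[|p] //=.
by rewrite mul0rn.
Qed.

Lemma d1_exp_t3 : d1 (exp_t3 K) = 0.
Proof.
rewrite /exp_t3 exp_uE (derivationM d1_derivation) (derivationX d1_derivation).
by rewrite d1_t2 d1_embed; ring.
Qed.

Lemma pd_u_fexp1 : pd_u (fpsC (fexp 1)) = fpsC (fexp (1 : K)).
Proof.
apply/fpsP => -[|p] /=; first by rewrite fps_deriv_fexp rmorph1 mul1r.
exact: (derivation0 (@fps_deriv_derivation _)).
Qed.

(** In (t^2)^3 e^u the derivative of the cube, 3 (t^2)^2 e^u, cancels the chain-rule term (t^2)^3
    (-3 / t^2) e^u. *)
Lemma d2_exp_t3 : d2 (exp_t3 K) = 0.
Proof.
rewrite /exp_t3 exp_uE (derivationM d2_derivation) (derivationX d2_derivation).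
rewrite d2_t2 d2_embed pd_u_fexp1.
move: t2K; move: (Defs.t2 K) (Defs.t2V K) (embed _) => x y E xy.
rewrite [LHS](_ : _ = 3 * x ^+ 2 * E * (1 - x * y)); last by ring.
by rewrite xy subrr mulr0.
Qed.

Lemma d3_exp_t3 : d3 (exp_t3 K) = exp_t3 K.
Proof.
rewrite /exp_t3 exp_uE (derivationM d3_derivation) (derivationX d3_derivation).
by rewrite d3_t2 d3_embed pd_u_fexp1; ring.
Qed.

End Embedding.

(** * The open WDVV equations *)

Section PotentialTables.
Context (A : comNzRingType) (t1 t2 t2V t3 s h e T : A).
Context (D1 D2 D3 Ds : A -> A).
Hypotheses (dD1 : derivation D1) (dD2 : derivation D2) (dD3 : derivation D3).
Hypotheses (dDs : derivation Ds) (h2 : h * 2 = 1) (e24 : e * 24 = 1).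
Hypotheses (D1_t1 : D1 t1 = 1) (D2_t1 : D2 t1 = 0) (D3_t1 : D3 t1 = 0).
Hypotheses (D1_t2 : D1 t2 = 0) (D2_t2 : D2 t2 = 1) (D3_t2 : D3 t2 = 0).
Hypotheses (D1_t3 : D1 t3 = 0) (D2_t3 : D2 t3 = 0) (D3_t3 : D3 t3 = 1).
Hypotheses (D1_s : D1 s = 0) (D2_s : D2 s = 0) (D3_s : D3 s = 0).
Hypotheses (D1_h : D1 h = 0) (D2_h : D2 h = 0) (D3_h : D3 h = 0).
Hypotheses (D1_e : D1 e = 0) (D2_e : D2 e = 0) (D3_e : D3 e = 0).
Hypotheses (D1_T : D1 T = 0) (D2_T : D2 T = 0) (D3_T : D3 T = T).
Hypotheses (Ds_t1 : Ds t1 = 0) (Ds_t2 : Ds t2 = 0) (Ds_s : Ds s = 1).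
Hypothesis t2K : t2 * t2V = 1.

Definition partial (a : nat) : A -> A := match a with 0 => D1 | 1 => D2 | _ => D3 end.

Let rules1 := (derivationD dD1, derivationB dD1, derivationN dD1,
  derivationM dD1, derivationX dD1, derivation_nat dD1, derivation0 dD1,
  derivation1 dD1,
  D1_t1, D1_t2, D1_t3, D1_s, D1_h, D1_e, D1_T).
Let rules2 := (derivationD dD2, derivationB dD2, derivationN dD2,
  derivationM dD2, derivationX dD2, derivation_nat dD2, derivation0 dD2,
  derivation1 dD2,
  D2_t1, D2_t2, D2_t3, D2_s, D2_h, D2_e, D2_T).
Let rules3 := (derivationD dD3, derivationB dD3, derivationN dD3,
  derivationM dD3, derivationX dD3, derivation_nat dD3, derivation0 dD3,
  derivation1 dD3,
  D3_t1, D3_t2, D3_t3, D3_s, D3_h, D3_e, D3_T).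

Let F := h * t1 ^+ 2 * t3 + h * t1 * t2 ^+ 2 - e * t2 ^+ 4 + t2 * T.

Definition hess_F (a b : nat) : A :=
  match a, b with
  | 0, 0 => t3 | 1, 1 => t1 - e * 12 * t2 ^+ 2 | 0, 1 | 1, 0 => t2
  | 1, 2 | 2, 1 => T | 2, 2 => t2 * T | _, _ => t1
  end.

Definition third_F (a b c : nat) : A :=
  match a, b, c with
  | 0, b, c => (b + c == 2)%:R | a, 0, c => (a + c == 2)%:R
  | a, b, 0 => (a + b == 2)%:R
  | 1, 1, 1 => - t2 | 2, 2, 2 => t2 * T
  | 1, 1, 2 | 1, 2, 1 | 2, 1, 1 => 0 | _, _, _ => T
  end.

Lemma hess_FE a b : (a < 3)%N -> (b < 3)%N -> partial a (partial b F) = hess_F a b.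
Proof.
have e1 : D1 F = t1 * t3 + h * t2 ^+ 2.
  rewrite /F !rules1 /= [LHS](_ : _ = h * 2 * (t1 * t3) + h * t2 ^+ 2).
    by rewrite h2 mul1r.
  by ring.
have e2 : D2 F = t1 * t2 - e * 4 * t2 ^+ 3 + T.
  rewrite /F !rules2 /= [LHS](_ : _ = h * 2 * (t1 * t2) - e * 4 * t2 ^+ 3 + T).
    by rewrite h2 mul1r.
  by ring.
have e3 : D3 F = h * t1 ^+ 2 + t2 * T by rewrite /F !rules3 /=; ring.
case: a b => [|[|[|//]]] [|[|[|//]]] _ _ /=;
  rewrite ?e1 ?e2 ?e3 ?rules1 ?rules2 ?rules3 /=;
  try by ring.
- by rewrite [LHS](_ : _ = h * 2 * t1); [rewrite h2 mul1r | ring].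
- by rewrite [LHS](_ : _ = h * 2 * t2); [rewrite h2 mul1r | ring].
Qed.

Lemma third_FE a b c : (a < 3)%N -> (b < 3)%N -> (c < 3)%N ->
  partial a (partial b (partial c F)) = third_F a b c.
Proof.
move=> la lb lc; rewrite hess_FE //.
case: a b c la lb lc => [|[|[|//]]] [|[|[|//]]] [|[|[|//]]] _ _ _ /=;
  rewrite ?rules1 ?rules2 ?rules3 /= ?mulr0 ?mul0r ?addr0 ?add0r //; try by ring.
by rewrite [LHS](_ : _ = - (e * 24) * t2); [rewrite e24 mulN1r | ring].
Qed.

Context (f fu fuu fs fsu fss E : A).
Hypotheses (D1_f : D1 f = 0) (D2_f : D2 f = - 3 * t2V * fu) (D3_f : D3 f = fu).
Hypotheses (D1_fu : D1 fu = 0) (D2_fu : D2 fu = - 3 * t2V * fuu).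
Hypotheses (D3_fu : D3 fu = fuu).
Hypotheses (D1_fs : D1 fs = 0) (D2_fs : D2 fs = - 3 * t2V * fsu).
Hypotheses (D3_fs : D3 fs = fsu).
Hypotheses (Ds_f : Ds f = fs) (Ds_fu : Ds fu = fsu) (Ds_fs : Ds fs = fss).

Let Fo := s * t1 + t2 ^+ 2 * f.

(** Since u_{t^2} = -3 / t^2, the derivative in t^2 sends (t^2)^m f to (t^2)^(m-1) (m f - 3 f_u);
    applied twice from m = 2 this gives 2 f - 9 f_u + 9 f_uu. *)
Definition hess_Fo (a b : nat) : A :=
  match a, b with
  | 1, 1 => 2 * f - 9 * fu + 9 * fuu
  | 1, 2 | 2, 1 => t2 * (2 * fu - 3 * fuu)
  | 2, 2 => t2 ^+ 2 * fuu
  | _, _ => 0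
  end.

Definition grad_s_Fo (a : nat) : A :=
  match a with
  | 0 => 1 | 1 => t2 * (2 * fs - 3 * fsu) | _ => t2 ^+ 2 * fsu
  end.

Let rulesS := (derivationD dDs, derivationB dDs, derivationN dDs,
  derivationM dDs, derivationX dDs, derivation_nat dDs, derivation0 dDs,
  derivation1 dDs,
  Ds_t1, Ds_t2, Ds_s, Ds_f, Ds_fu, Ds_fs).

Lemma d1_FoE : D1 Fo = s.
Proof. by rewrite /Fo !rules1 D1_f /=; ring. Qed.

Lemma d2_FoE : D2 Fo = t2 * (2 * f - 3 * fu).
Proof. by rewrite /Fo !rules2 D2_f /=; ring: t2K. Qed.

Lemma d3_FoE : D3 Fo = t2 ^+ 2 * fu.
Proof. by rewrite /Fo !rules3 D3_f /=; ring. Qed.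

Lemma ds_FoE : Ds Fo = t1 + t2 ^+ 2 * fs.
Proof. by rewrite /Fo !rulesS /=; ring. Qed.

Lemma quasihomogeneous_FoE : t1 * D1 Fo + h * t2 * D2 Fo + h * 3 * D3 Fo = Fo.
Proof.
rewrite d1_FoE d2_FoE d3_FoE.
rewrite [LHS](_ : _ = s * t1 + h * 2 * (t2 ^+ 2 * f)); last by ring.
by rewrite h2 mul1r.
Qed.

Lemma hess_FoE a b : (a < 3)%N -> (b < 3)%N ->
  partial a (partial b Fo) = hess_Fo a b.
Proof.
case: a b => [|[|[|//]]] [|[|[|//]]] _ _ /=; rewrite ?d1_FoE ?d2_FoE ?d3_FoE.
- by rewrite D1_s.
- by rewrite !rules1 D1_f D1_fu; ring.
- by rewrite !rules1 D1_fu; ring.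
- by rewrite D2_s.
- by rewrite !rules2 D2_f D2_fu; ring: t2K.
- by rewrite !rules2 D2_fu; ring: t2K.
- by rewrite D3_s.
- by rewrite !rules3 D3_f D3_fu; ring.
- by rewrite !rules3 D3_fu; ring.
Qed.

Lemma grad_s_FoE a : (a < 3)%N -> partial a (Ds Fo) = grad_s_Fo a.
Proof.
case: a => [|[|[|//]]] _ /=; rewrite ds_FoE.
- by rewrite !rules1 D1_fs; ring.
- by rewrite !rules2 D2_fs; ring: t2K.
- by rewrite !rules3 D3_fs; ring.
Qed.

Lemma ds_grad_FoE a : (a < 3)%N -> Ds (partial a Fo) = grad_s_Fo a.
Proof.
case: a => [|[|[|//]]] _ /=; rewrite ?d1_FoE ?d2_FoE ?d3_FoE.
- exact: Ds_s.
- by rewrite !rulesS; ring.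
- by rewrite !rulesS /=; ring.
Qed.

Lemma dss_FoE : Ds (Ds Fo) = t2 ^+ 2 * fss.
Proof. by rewrite ds_FoE !rulesS /=; ring. Qed.

Hypothesis TE : T = t2 ^+ 3 * E.
Hypotheses (eq22s : 4 * fsu - 2 * fs + (2 * f - 9 * fu + 9 * fuu) * fss
  = (2 * fs - 3 * fsu) ^+ 2).
Hypotheses (eq23s : E + (2 * fu - 3 * fuu) * fss = (2 * fs - 3 * fsu) * fsu).
Hypotheses (eq33s : E * (1 + 2 * fs - 3 * fsu) + fuu * fss = fsu ^+ 2).
Hypotheses (eq223 : fuu - (2 * fu - 3 * fuu) + (2 * f - 9 * fu + 9 * fuu) * fsu
  = (2 * fu - 3 * fuu) * (2 * fs - 3 * fsu)).
Hypotheses (eq323 : 2 * fu * fsu - fuu * (2 * fs)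
  = E * (2 * f - 9 * fu + 9 * fuu)).

(** An equation follows from l = r once the difference of its sides is a multiple of l - r; below, c
    is, up to sign, the power of t^2 that factors out. *)
Let lin_eq (c l r x z : A) : l = r -> x - z = c * (l - r) -> x = z.
Proof. by move=> ->; rewrite subrr mulr0 => /eqP; rewrite subr_eq0 => /eqP. Qed.

(** The antidiagonal metric pairs index 1 with 3 and 2 with itself, which leaves three products in
    each contraction. The equation is antisymmetric under exchange of alpha and gamma, and apart
    from (2,2,3), (2,3,3) and their mirror images every case is an identity. *)
Lemma wdvv_ttt a b c : (a < 3)%N -> (b < 3)%N -> (c < 3)%N ->
  third_F a b 0 * hess_Fo 2 c + third_F a b 1 * hess_Fo 1 c
    + third_F a b 2 * hess_Fo 0 c + hess_Fo a b * grad_s_Fo c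
  = third_F c b 0 * hess_Fo 2 a + third_F c b 1 * hess_Fo 1 a
    + third_F c b 2 * hess_Fo 0 a + hess_Fo c b * grad_s_Fo a.
Proof.
case: a b c => [|[|[|//]]] [|[|[|//]]] [|[|[|//]]] _ _ _ //=;
  rewrite ?TE; try by ring.
- by apply: (lin_eq (c := t2 ^+ 2) eq223); ring.
- by apply: (lin_eq (c := t2 ^+ 3) eq323); ring.
- by apply: (lin_eq (c := - t2 ^+ 2) eq223); ring.
- by apply: (lin_eq (c := - t2 ^+ 3) eq323); ring.
Qed.

Lemma wdvv_tts a b : (a < 3)%N -> (b < 3)%N ->
  third_F a b 0 * grad_s_Fo 2 + third_F a b 1 * grad_s_Fo 1
    + third_F a b 2 * grad_s_Fo 0 + hess_Fo a b * (t2 ^+ 2 * fss)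
  = grad_s_Fo b * grad_s_Fo a.
Proof.
case: a b => [|[|[|//]]] [|[|[|//]]] _ _ //=; rewrite ?TE; try by ring.
- by apply: (lin_eq (c := t2 ^+ 2) eq22s); ring.
- by apply: (lin_eq (c := t2 ^+ 3) eq23s); ring.
- by apply: (lin_eq (c := t2 ^+ 3) eq23s); ring.
- by apply: (lin_eq (c := t2 ^+ 4) eq33s); ring.
Qed.

End PotentialTables.

Section OpenWDVV.
Context (K : numClosedFieldType).
Local Notation partial := (partial (@d1 K) (@d2 K) (@d3 K)).

Lemma dtE (al : 'I_3) (X : series K) : dt al X = partial al X.
Proof. by rewrite /dt; case: al => [[|[|m]]]. Qed.

Lemma sum3 (V : nmodType) (X : 'I_3 -> V) :
  \sum_i X i = X (inord 0) + X (inord 1) + X (inord 2).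
Proof.
rewrite !big_ord_recl big_ord0 addr0 -addrA; congr (X _ + (X _ + X _));
  by apply: val_inj; rewrite /= inordK.
Qed.

Lemma cst_half : cst (1 / 2) * 2 = 1 :> series K.
Proof.
rewrite -(cst_nat K 2) -cstM -(cst1 K); congr cst.
by field.
Qed.

Lemma cst_24th : cst (1 / 24) * 24 = 1 :> series K.
Proof.
rewrite -(cst_nat K 24) -cstM -(cst1 K); congr cst.
by field.
Qed.

Lemma third_potential a b c : (a < 3)%N -> (b < 3)%N -> (c < 3)%N ->
  partial a (partial b (partial c (potential K))) = third_F (t2 K) (exp_t3 K) a b c.
Proof.
exact: (third_FE (@d1_derivation K) (@d2_derivation K) (@d3_derivation K)
  cst_half cst_24th (d1_t1 K) (d2_t1 K) (d3_t1 K) (d1_t2 K) (d2_t2 K) (d3_t2 K)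
  (d1_t3 K) (d2_t3 K) (d3_t3 K) (d1_cst _) (d2_cst _) (d3_cst _)
  (d1_cst _) (d2_cst _) (d3_cst _) (d1_exp_t3 K) (d2_exp_t3 K) (d3_exp_t3 K)).
Qed.

(** The antidiagonal matrix is an involution, so the inverse metric has the same entries as the
    metric. *)
Definition eta_inv : 'M[series K]_3 := \matrix_(mu, nu) (mu + nu == 2)%N%:R.

Lemma eta_invE (X Y : 'I_3 -> series K) (x y : nat -> series K) :
  (forall mu, X mu = x mu) -> (forall nu, Y nu = y nu) ->
  \sum_mu \sum_nu X mu * eta_inv mu nu * Y nu
  = x 0%N * y 2%N + x 1%N * y 1%N + x 2%N * y 0%N.
Proof.
move=> Xx Yy; rewrite sum3 !sum3 !mxE !inordK // !Xx !Yy !inordK //=.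
by move: (x _) (x _) (x _) (y _) (y _) (y _) => *; ring.
Qed.

Lemma metric_potential : metric (potential K) *m eta_inv = 1%:M.
Proof.
have metricE i j : metric (potential K) i j = (i + j == 2)%N%:R.
  by rewrite mxE !dtE third_potential.
apply/matrixP => i j; rewrite mxE sum3 !metricE !mxE !inordK //.
by case: i j => [[|[|[|//]]] ?] [[|[|[|//]]] ?]; rewrite /=; ring.
Qed.

Context (f : fps (fps K)).
Let fu := pd_u f.
Let fuu := pd_u fu.
Let fs := pd_s f.
Let fsu := pd_u fs.
Let fss := pd_s fs.
Hypothesis f_eqs :
  [/\ 4 * fsu - 2 * fs + (2 * f - 9 * fu + 9 * fuu) * fss
        = (2 * fs - 3 * fsu) ^+ 2,
      fpsC (fexp 1) + (2 * fu - 3 * fuu) * fss = (2 * fs - 3 * fsu) * fsu,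
      fpsC (fexp 1) * (1 + 2 * fs - 3 * fsu) + fuu * fss = fsu ^+ 2,
      fuu - (2 * fu - 3 * fuu) + (2 * f - 9 * fu + 9 * fuu) * fsu
        = (2 * fu - 3 * fuu) * (2 * fs - 3 * fsu) &
      2 * fu * fsu - fuu * (2 * fs) = fpsC (fexp 1) * (2 * f - 9 * fu + 9 * fuu)].

Let Fo := s K * t1 K + t2 K ^+ 2 * embed f.

Let Ds_f : ds (embed f) = embed fs. Proof. exact: ds_embed. Qed.
Let Ds_fu : ds (embed fu) = embed fsu.
Proof. exact: etrans (ds_embed _) (congr1 _ (pd_suC f)). Qed.
Let Ds_fs : ds (embed fs) = embed fss. Proof. exact: ds_embed. Qed.

Let HFo := hess_Fo (t2 K) (embed f) (embed fu) (embed fuu).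
Let GFo := grad_s_Fo (t2 K) (embed fs) (embed fsu).

Lemma hess_open_potential a b : (a < 3)%N -> (b < 3)%N ->
  partial a (partial b Fo) = HFo a b.
Proof.
exact: (hess_FoE (@d1_derivation K) (@d2_derivation K) (@d3_derivation K)
  (d1_t1 K) (d2_t1 K) (d3_t1 K) (d1_t2 K) (d2_t2 K) (d3_t2 K)
  (d1_s K) (d2_s K) (d3_s K) (t2K K) (d1_embed _) (d2_embed _) (d3_embed _)
  (d1_embed _) (d2_embed _) (d3_embed _)).
Qed.

Lemma grad_ds_open_potential a : (a < 3)%N -> partial a (ds Fo) = GFo a.
Proof.
exact: (grad_s_FoE (@d1_derivation K) (@d2_derivation K) (@d3_derivation K)
  (@ds_derivation K) (d1_t1 K) (d2_t1 K) (d3_t1 K) (d1_t2 K) (d2_t2 K) (d3_t2 K)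
  (ds_mon _ _ _ _) (ds_mon _ _ _ _) (ds_s K) (t2K K)
  (d1_embed _) (d2_embed _) (d3_embed _) Ds_f).
Qed.

Lemma ds_grad_open_potential a : (a < 3)%N -> ds (partial a Fo) = GFo a.
Proof.
exact: (ds_grad_FoE (@d1_derivation K) (@d2_derivation K) (@d3_derivation K)
  (@ds_derivation K) (d1_t1 K) (d2_t1 K) (d3_t1 K) (d1_t2 K) (d2_t2 K) (d3_t2 K)
  (d1_s K) (d2_s K) (d3_s K) (ds_mon _ _ _ _) (ds_s K) (t2K K)
  (d1_embed _) (d2_embed _) (d3_embed _) Ds_f Ds_fu).
Qed.

Lemma dss_open_potential : ds (ds Fo) = t2 K ^+ 2 * embed fss.
Proof.
exact: (dss_FoE (@ds_derivation K) (ds_mon _ _ _ _) (ds_mon _ _ _ _) (ds_s K)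
  Ds_f Ds_fs).
Qed.

Let exp_t3E : exp_t3 K = t2 K ^+ 3 * embed (fpsC (fexp 1)).
Proof. by rewrite /exp_t3 exp_uE. Qed.

Let embed_eq X Y : X = Y -> embed X = embed Y :> series K.
Proof. exact: congr1. Qed.

Let embedE := (rmorphXn (@embed K), rmorphD (@embed K), rmorphN (@embed K),
  rmorphM (@embed K), rmorph_nat (@embed K), rmorph1 (@embed K)).

Lemma open_WDVV_sol : open_WDVV (potential K) Fo.
Proof.
have [/embed_eq e1 /embed_eq e2 /embed_eq e3 /embed_eq e4 /embed_eq e5] := f_eqs.
move: e1 e2 e3 e4 e5; rewrite !embedE => e1 e2 e3 e4 e5.
have thirdE (al be mu : 'I_3) : dt al (dt be (dt mu (potential K)))
    = third_F (t2 K) (exp_t3 K) al be mu by rewrite !dtE third_potential.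
have hessE (nu ga : 'I_3) : dt nu (dt ga Fo) = HFo nu ga.
  by rewrite !dtE hess_open_potential.
have gradE (nu : 'I_3) : dt nu (ds Fo) = GFo nu.
  by rewrite !dtE grad_ds_open_potential.
have dsgradE (nu : 'I_3) : ds (dt nu Fo) = GFo nu.
  by rewrite !dtE ds_grad_open_potential.
exists eta_inv => [|al be ga]; first exact: metric_potential.
pose T3 := third_F (t2 K) (exp_t3 K).
have sumE (X : 'I_3 -> series K) (x : nat -> series K) (i j : 'I_3)
    (z w : series K) :
    (forall nu, X nu = x nu) -> z = w ->
    \sum_mu \sum_nu dt i (dt j (dt mu (potential K))) * eta_inv mu nu * X nu
      + dt i (dt j Fo) * z
    = T3 i j 0 * x 2 + T3 i j 1 * x 1 + T3 i j 2 * x 0 + HFo i j * w.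
  by move=> Xx ->; rewrite hessE (eta_invE (x := fun n => T3 i j n) _ Xx).
split.
  rewrite (sumE _ (fun n => HFo n ga) _ _ _ _ (hessE^~ ga) (dsgradE ga)).
  rewrite (sumE _ (fun n => HFo n al) _ _ _ _ (hessE^~ al) (dsgradE al)).
  exact: (wdvv_ttt exp_t3E e4 e5 (ltn_ord al) (ltn_ord be) (ltn_ord ga)).
rewrite (sumE _ GFo _ _ _ _ gradE dss_open_potential) !dsgradE.
exact: (wdvv_tts exp_t3E e1 e2 e3 (ltn_ord al) (ltn_ord be)).
Qed.

Lemma open_potential_quasihomogeneous : quasihomogeneous Fo.
Proof.
have h3 : cst (3 / 2) = cst (1 / 2) * 3 :> series K.
  by rewrite -(cst_nat K 3) -cstM; apply: (congr1 (@cst K)); field.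
rewrite /quasihomogeneous h3.
exact: (quasihomogeneous_FoE (@d1_derivation K) (@d2_derivation K)
  (@d3_derivation K) cst_half (d1_t1 K) (d2_t1 K) (d3_t1 K) (d1_t2 K) (d2_t2 K)
  (d3_t2 K) (d1_s K) (d2_s K) (d3_s K) (t2K K) (d1_embed _) (d2_embed _)
  (d3_embed _)).
Qed.

Lemma dt0_dt_open_potential (al : 'I_3) : dt 0 (dt al Fo) = 0.
Proof. by rewrite !dtE hess_open_potential. Qed.

Lemma dt0_ds_open_potential : dt 0 (ds Fo) = 1.
Proof. by rewrite dtE grad_ds_open_potential. Qed.

End OpenWDVV.

Lemma open_potential_exists (K : numClosedFieldType) :
  exists b d : nat -> nat -> K,
    [/\ b 1%N 1%N = - 8, d 1%N 1%N = 1,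
        forall k q : nat, rec_even b d k q,
        forall k q : nat, rec_odd b d k q
      & let Fo := open_potential b d in
        [/\ open_WDVV (potential K) Fo,
            quasihomogeneous Fo,
            forall al : 'I_3, dt 0 (dt al Fo) = 0
          & dt 0 (ds Fo) = 1]].
Proof.
have [q [r [q0 qr q3]]] := cubic_series K.
have phiP := open_solP q0 qr q3.
have [b [d [b11 d11 phi_odd phi_even]]] := open_sol_expansion q0 qr q3.
have [_ _ _ _ phi5] := phiP.
exists b, d; split=> // [k p|k p|].
- exact: (rec_even_sol phi_odd phi_even phi5).
- exact: (rec_odd_sol phi_odd phi_even phi5).
move=> Fo; have -> : Fo = s K * t1 K + t2 K ^+ 2 * embed (open_sol q r).
  rewrite /Fo /open_potential; congr (_ + _ * _).
  apply/fpsP => i; apply/fpsP => j.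
  exact: (congr1 (fun x => ma_mon x (0 : exponent)) (a_coefE phi_odd phi_even i j)).
split.
- exact: open_WDVV_sol.
- exact: open_potential_quasihomogeneous.
- exact: dt0_dt_open_potential.
- exact: dt0_ds_open_potential.
Qed.

Theorem proposition2p2 (R : realType) :
  exists b d : nat -> nat -> R[i],
    [/\ b 1 1 = -8, d 1 1 = 1,
        forall k q : nat, rec_even b d k q,
        forall k q : nat, rec_odd b d k q
      & let Fo := open_potential b d in
        [/\ open_WDVV (potential R[i]) Fo,
            quasihomogeneous Fo,
            forall al : 'I_3, dt 0 (dt al Fo) = 0
          & dt 0 (ds Fo) = 1]].
Proof. exact: open_potential_exists. Qed.
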